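(* Let $\Gamma$ be a finite simple graph. Then there exists a finite group $G$ whose codegree graph $\Gamma(G)$ is isomorphic to $\Gamma$ if and only if the complement graph $\overline{\Gamma}$ is triangle-free and $3$-colorable.
   Context: For a finite group $G$ and $\chi\in{\rm Irr}(G)$ (complex irreducible characters), the codegree of $\chi$ is ${\rm cod}(\chi)=|G:\ker\chi|/\chi(1)$, and ${\rm cod}(G)$ is the set of codegrees of $G$. The codegree graph $\Gamma(G)$ is the graph whose vertices are the primes dividing some element of ${\rm cod}(G)$ (equivalently, the prime divisors of $|G|$), two distinct primes $p,q$ being adjacent iff $pq$ divides some element of ${\rm cod}(G)$. The complement $\overline{\Gamma}$ of a graph $\Gamma$ has the same vertex set, with two distinct vertices adjacent iff they are not adjacent in $\Gamma$. *)

(* Defs.v *)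
From HB Require Import structures.
From mathcomp Require Import all_boot all_order all_algebra all_fingroup all_solvable all_field all_character.
Set Implicit Arguments. Unset Strict Implicit. Unset Printing Implicit Defensive.
Import GRing.Theory Num.Theory.
Local Open Scope ring_scope.

Definition codegree (gT : finGroupType) (G : {group gT}) (i : Iirr G) : algC :=
  (#|G : cfker 'chi[G]_i|%g)%:R / 'chi[G]_i 1%g.

(* n divides some codegree of G (divisibility of complex algebraic numbers,
   as codegrees are integers). *)
Definition divides_some_cod (gT : finGroupType) (G : {group gT}) (n : nat) : bool :=
  [exists i : Iirr G, (n%:R %| codegree i)%C].

Definition cod_vertex (gT : finGroupType) (G : {group gT}) (p : nat) : bool :=
  prime p && divides_some_cod G p.

Definition cod_adj (gT : finGroupType) (G : {group gT}) (p q : nat) : bool :=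
  [&& cod_vertex G p, cod_vertex G q, p != q & divides_some_cod G (p * q)%N].

Definition simple_graph (T : finType) (e : rel T) : Prop :=
  irreflexive e /\ symmetric e.

Definition compl_rel (T : finType) (e : rel T) : rel T :=
  fun x y => (x != y) && ~~ e x y.

Definition triangle_free (T : finType) (e : rel T) : Prop :=
  ~ exists x y z : T, [&& e x y, e y z & e x z].

Definition three_colorable (T : finType) (e : rel T) : Prop :=
  exists c : T -> 'I_3, forall x y, e x y -> c x != c y.

Definition iso_codegree_graph (T : finType) (e : rel T)
    (gT : finGroupType) (G : {group gT}) : Prop :=
  exists f : T -> nat,
    [/\ injective f,
        (forall p, cod_vertex G p <-> exists x, f x = p)
      & forall x y, e x y = cod_adj G (f x) (f y)].

(* Main.v *)
(** If [p] does not divide [cod chi], then [chi], seen in [G / ker chi], has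
    [p]-defect zero, so it vanishes outside the elements whose [p]-part lies in the
    kernel. For primes [p], [q] with no codegree divisible by [pq], column
    orthogonality then shows that nontrivial [p]- and [q]-elements never commute,
    and that of a [p]-element [x] and a [q]-element [y] exactly one lies in the normal
    closure of the other. Writing [T_q] for the subgroup generated by all
    [q]-elements, it follows that [p] divides [|G : T_q|] or [q] divides [|G : T_p|];
    write [p -> q] in the first case. Frattini's argument turns a directed path of
    non-adjacent primes into a tower of subgroups, each normalizing all later ones and
    acting without fixed points on the next. A tower has at most three stages, and in one
    of three stages the first and the last contain commuting nontrivial elements; this
    excludes triangles and bounds the directed paths, and colouring a vertex by whether
    it has arrows in and out gives three colours.

    Conversely, colour the vertices of the complement by 0, 1, 2. The group is
    [W : (C : T0)] with [T0] cyclic of order the product of the primes of colour 0, [C]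
    cyclic with one Sylow subgroup for each vertex [d] of colour 1, on which exactly the
    colour-0 neighbours of [d] act nontrivially, and [W] a sum over the vertices [i] of
    colour 2 of modules induced from a linear character of the subgroup
    [A_i = C O_N(T0)], with [N] the colour-0 neighbours of [i]; its kernel [K_i] is the
    Hall subgroup of [C] for the non-neighbours of [i], and [A_i / K_i] is cyclic
    because the graph is triangle-free. *)
From HB Require Import structures.
From mathcomp Require Import ring zify.
From mathcomp Require Import all_boot all_order all_algebra all_fingroup all_solvable all_field all_character.
Require Import Defs.
Set Implicit Arguments. Unset Strict Implicit. Unset Printing Implicit Defensive.
Import Order.TTheory GRing.Theory Num.Theory.
Local Open Scope ring_scope.

(** * Characters of defect zero *)

(** Evaluate [(X^n - 1) / (X - 1)] at 1, once as the product over its roots and once as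
    [1 + X + ... + X^(n-1)]. *)
Lemma prod_one_sub_root (F : fieldType) (n : nat) (z : F) :
  n.-primitive_root z -> \prod_(1 <= k < n) (1 - z ^+ k) = n%:R.
Proof.
move=> prim_z; have n_gt0 := prim_order_gt0 prim_z.
have:= factor_Xn_sub_1 prim_z; rewrite big_ltn // (subrX1 'X n) expr0.
have X1nz: 'X - 1%:P != 0 :> {poly F} by rewrite polyXsubC_eq0.
move/(mulfI X1nz)/(congr1 (fun P : {poly F} => P.[1])).
rewrite horner_prod (eq_bigr (fun k => 1 - z ^+ k)); last first.
  by move=> k _; rewrite !hornerE.
move=> ->; rewrite horner_sum (eq_bigr (fun=> 1)) ?sumr_const ?card_ord // => k _.
by rewrite hornerXn expr1n.
Qed.

(** The Galois conjugates [M / (1 - z^k)], [0 < k < p], are algebraic integers too, and their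
    product is the rational number [M^(p-1) / p]. *)
Lemma dvdn_of_Aint_div (p M : nat) (z : algC) :
  prime p -> p.-primitive_root z -> M%:R / (1 - z) \in Aint -> (p %| M)%N.
Proof.
move=> p_pr prim_z intM.
suffices /Cint_rat_Aint: (M ^ p.-1)%:R / p%:R \in Aint.
  rewrite rpred_div ?rpred_nat // => /(_ isT) int_q.
  have: (p %| (M ^ p.-1)%N)%C.
    by apply/dvdCP; exists ((M ^ p.-1)%:R / p%:R) => //; rewrite divfK // pnatr_eq0 -lt0n prime_gt0.
  by rewrite dvdC_nat Euclid_dvdX // => /andP[].
rewrite -(prod_one_sub_root prim_z) natrX -subn1 -prodr_const_nat -prodf_div.
rewrite big_nat rpred_prod // => k /andP[k_gt0 lt_k_p].
have co_kp: coprime k p by rewrite coprime_sym prime_coprime // gtnNdvd.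
have [u uE] := Qn_aut_exists co_kp.
have:= Aint_aut u (M%:R / (1 - z)); rewrite intM fmorph_div rmorph_nat rmorphB rmorph1.
by rewrite uE // prim_expr_order.
Qed.

Lemma eqAmod_det (n : nat) (A B : 'M[algC]_n) (d : algC) :
    A \is a mxOver Aint -> B \is a mxOver Aint ->
  (forall i j, A i j == B i j %[mod d])%A -> (\det A == \det B %[mod d])%A.
Proof.
move=> /mxOverP intA /mxOverP intB eqAB; rewrite /determinant.
elim/big_rec2: _ => [|s x y _ IH]; first exact: eqAmod_refl.
apply: eqAmodD IH; apply: eqAmodM; rewrite ?rpredX ?rpredN ?rpred1 ?eqAmod_refl //.
  by rewrite rpred_prod.
suffices []: [/\ (\prod_i A i (s i) == \prod_i B i (s i) %[mod d])%A,
    \prod_i A i (s i) \in Aint & \prod_i B i (s i) \in Aint] by [].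
elim/big_rec2: _ => [|i z t _ [IHe zA tA]]; first by rewrite eqAmod_refl rpred1.
by split; [apply: eqAmodM | apply: rpredM | apply: rpredM].
Qed.

(** Modulo [d] the determinant is [m ^+ n], so it cannot vanish. *)
Lemma unitmx_eqAmod_scalar (n : nat) (A : 'M[algC]_n) (m d : algC) :
    A \is a mxOver Aint -> m \in Aint -> (forall i j, A i j == (m%:M : 'M_n) i j %[mod d])%A ->
  (m ^+ n \notin dvdA d)%A -> A \in unitmx.
Proof.
move=> intA int_m eqAm; rewrite unitmxE unitfE; apply: contraNneq => detA0.
have:= eqAmod_det intA (mxOver_scalar (rpred0 _) int_m) eqAm.
by rewrite detA0 det_scalar eqAmod_sym eqAmod0.
Qed.

Section Vanishing.

Variables (gT : finGroupType) (G : {group gT}) (p : nat) (i : Iirr G) (M : nat) (g : gT).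
Hypotheses (p_pr : prime p) (MchiE : M%:R * 'chi_i 1%g = #|G|%:R) (p'M : ~~ (p %| M)%N).
Hypotheses (Gg : g \in G) (p_g : (p %| #[g]%g)%N).

Let kmx (F : gT -> gT -> algC) : 'M[algC]_#|G| := \matrix_(a, b) F (enum_val a) (enum_val b).

Let kmxM F1 F2 :
  kmx F1 *m kmx F2 = kmx (fun x y => \sum_(z in G) F1 x z * F2 z y).
Proof. by apply/matrixP=> a b; rewrite !mxE [RHS]big_enum_val; apply: eq_bigr => c _; rewrite !mxE. Qed.

Let eq_kmx F1 F2 : {in G &, F1 =2 F2} -> kmx F1 = kmx F2.
Proof. by move=> eqF; apply/matrixP=> a b; rewrite !mxE eqF // enum_valP. Qed.

(** Coefficients of the central idempotent of ['chi_i] in the group algebra, as [1 / M] is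
    ['chi_i 1 / #|G|]. *)
Let e z := 'chi_i z^-1%g / M%:R.

Let M_nz : M%:R != 0 :> algC.
Proof. by apply: contraNneq (p'M) => /eqP; rewrite pnatr_eq0 => /eqP->. Qed.

Let eM : {in G, forall w, \sum_(x in G) e (w * x)%g * e x^-1%g = e w}.
Proof.
move=> w Gw; have := generalized_orthogonality_relation w^-1%g i i.
rewrite eqxx mul1r => /(canRL (mulVKf (neq0CG G))) chiE.
rewrite (reindex_inj invg_inj) /=.
transitivity ((M%:R ^- 2) * \sum_(x in G) 'chi_i (x * w^-1)%g * 'chi_i x^-1%g).
  rewrite mulr_sumr; apply: eq_big => [x|x Gx]; first exact: groupV.
  by rewrite /e invMg !invgK; field.
by rewrite chiE /e -MchiE; field; rewrite M_nz irr1_neq0.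
Qed.

Let eJ x z : z \in G -> e (x ^ z)%g = e x.
Proof. by move=> Gz; rewrite /e -conjVg cfunJ. Qed.

(** [k x] is the exponent of [g] in [x = g^k r], with [r] the representative of the coset [<[g]> x].
    It is determined modulo [#[g]], hence modulo [p]. *)
Let twist (z : algC) : p.-primitive_root z ->
  exists k : gT -> nat, forall x, z ^+ k (g * x)%g = z * z ^+ k x.
Proof.
move=> prim_z; pose r x := repr (<[g]> :* x)%g.
have /fin_all_exists[k kE]: forall x, exists k, (x * (r x)^-1 = g ^+ k)%g.
  move=> x; apply/cycleP; rewrite /r.
  have /rcosetP[y cy ->] := mem_repr_rcoset <[g]>%G x.
  by rewrite invMg mulgA mulgV mul1g groupV.
exists k => x; rewrite -exprS; apply/eqP; rewrite (eq_prim_root_expr prim_z).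
suffices: (k (g * x)%g == (k x).+1 %[mod #[g]%g])%N.
  by move/eqP/(congr1 (modn^~ p)); rewrite !modn_dvdm // => ->.
rewrite -eq_expg_mod_order -kE expgS -kE /r.
by rewrite rcosetM rcoset_id ?cycle_id // mulgA.
Qed.

Let eC x y : x \in G -> e (x * y)%g = e (y * x)%g.
Proof. by move=> Gx; rewrite -(eJ (x * y)%g Gx) conjgE !mulgA mulVg mul1g. Qed.

Let eMM x y : x \in G -> y \in G ->
  \sum_(w in G) e (x * w^-1)%g * e (w * y)%g = e (x * y)%g.
Proof.
move=> Gx Gy; rewrite -(eM (groupM Gx Gy)) [RHS](reindex_inj (h := fun w => (w * y)^-1)%g); last first.
  by move=> u v /invg_inj/mulIg.
by apply: eq_big => [w|w _]; rewrite ?groupV ?groupMr // invgK invMg mulgA mulgK.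
Qed.

Let dvdA_twist (z : algC) (k : nat) : p.-primitive_root z -> (1 - z %| z ^+ k - 1)%A.
Proof.
move=> prim_z; have ->: z ^+ k - 1 = (1 - z) * - (\sum_(j < k) z ^+ j).
  by rewrite subrX1; ring.
rewrite -eqAmod0; apply: eqAmodMr0; rewrite rpredN rpred_sum // => j _.
by rewrite rpredX ?(Aint_prim_root prim_z).
Qed.

(* [E] is left multiplication by the central idempotent of ['chi_i] on the group
   algebra, [A] that idempotent times [g], and the diagonal [f] conjugates
   multiplication by [g] into [z] times itself.  The compression [Psi] of [f] to
   the block of ['chi_i] is congruent to 1 modulo [1 - z], hence invertible. *)
Lemma irr_vanish_of_ndvd_order : 'chi_i g = 0.
Proof.
have [z prim_z] := C_prim_root_exists (prime_gt0 p_pr).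
have z_neq1 : z != 1.
  by rewrite -[z]expr1 -(prim_order_dvd prim_z) dvdn1 neq_ltn prime_gt1 ?orbT.
have [k kE] := twist prim_z; pose f x := z ^+ k x.
pose E := kmx (fun x y => e (x * y^-1)%g).
pose A := kmx (fun x y => e (x * y^-1 * g^-1)%g).
pose EfE := kmx (fun x y => \sum_(w in G) e (x * w^-1)%g * (f w * e (w * y^-1)%g)).
have G'g : g^-1%g \in G by rewrite groupV.
have EE : E *m E = E.
  by rewrite kmxM; apply: eq_kmx => x y Gx Gy; rewrite eMM ?groupV.
have EA : E *m A = A.
  rewrite kmxM; apply: eq_kmx => x y Gx Gy.
  by under eq_bigr do rewrite -mulgA; rewrite eMM ?groupM ?groupV ?mulgA.
have AE : A *m E = A.
  rewrite kmxM; apply: eq_kmx => x y Gx Gy.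
  under eq_bigr => w Gw do rewrite [e (_ * g^-1)%g]eC ?groupM ?groupV // mulgA.
  by rewrite eMM ?groupM ?groupV // [e (_ * g^-1)%g]eC ?groupM ?groupV // mulgA.
have EfE_E : E *m EfE = EfE.
  rewrite kmxM; apply: eq_kmx => x y Gx Gy.
  under eq_bigr do rewrite mulr_sumr.
  rewrite exchange_big /=; apply: eq_bigr => w Gw.
  by under eq_bigr do rewrite mulrA; rewrite -mulr_suml eMM ?groupV.
have E_EfE : EfE *m E = EfE.
  rewrite kmxM; apply: eq_kmx => x y Gx Gy.
  under eq_bigr do rewrite mulr_suml.
  rewrite exchange_big /=; apply: eq_bigr => w Gw.
  by under eq_bigr => v _ do rewrite -2!mulrA; rewrite -2!mulr_sumr eMM ?groupV.
pose AfE := kmx (fun x y => \sum_(w in G) e (x * w^-1 * g^-1)%g * (f w * e (w * y^-1)%g)).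
have A_EfE : A *m EfE = AfE.
  rewrite kmxM; apply: eq_kmx => x y Gx Gy.
  under eq_bigr do rewrite mulr_sumr.
  rewrite exchange_big /=; apply: eq_bigr => w Gw.
  under eq_bigr => v Gv do rewrite mulrA [e (_ * g^-1)%g]eC ?groupM ?groupV // mulgA.
  by rewrite -mulr_suml eMM ?groupM ?groupV // [e (_ * g^-1)%g]eC ?groupM ?groupV // mulgA.
have EfE_A : EfE *m A = z *: AfE.
  transitivity (kmx (fun x y => \sum_(w in G) e (x * w^-1)%g * (f w * e (w * y^-1 * g^-1)%g))).
    rewrite kmxM; apply: eq_kmx => x y Gx Gy.
    under eq_bigr do rewrite mulr_suml.
    rewrite exchange_big /=; apply: eq_bigr => w Gw.
    under eq_bigr => v _ do rewrite -2!mulrA -(mulgA _ y^-1%g).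
    by rewrite -2!mulr_sumr eMM ?groupM ?groupV ?mulgA.
  apply/matrixP=> a b; rewrite !mxE mulr_sumr.
  rewrite (reindex_inj (mulgI g)) /=; apply: eq_big => [w|w]; rewrite groupMl // => Gw.
  rewrite invMg mulgA /f kE; have Gb := enum_valP b.
  have ->: e (g * w * (enum_val b)^-1 * g^-1)%g = e (w * (enum_val b)^-1)%g.
    by rewrite -eC // !mulgA mulVg mul1g.
  by ring.
pose Psi := EfE + (1%:M - E).
have PsiA : Psi *m A = z *: (A *m Psi).
  by rewrite mulmxDl mulmxBl mul1mx EA subrr addr0 mulmxDr mulmxBr mulmx1 AE subrr addr0 A_EfE.
have unitPsi : Psi \in unitmx.
  (* The factor [M ^ 2] clears the denominators of [e]; since [f] is 1 modulo [1 - z], [C] is then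
     congruent to [M ^ 2] times the identity. *)
  pose C := (M ^ 2)%:R *: Psi.
  have CE a b : C a b - ((M ^ 2)%:R%:M : 'M_#|G|) a b =
      \sum_(w in G) 'chi_i (enum_val a * w^-1)^-1%g * 'chi_i (w * (enum_val b)^-1)^-1%g * (f w - 1).
    have [Ga Gb] := (enum_valP a, enum_valP b).
    have chiE x : 'chi_i x^-1%g = M%:R * e x by rewrite /e mulrC divfK.
    pose S1 := \sum_(w in G) e (enum_val a * w^-1)%g * (f w * e (w * (enum_val b)^-1)%g).
    transitivity (M%:R ^+ 2 * (S1 - e (enum_val a * (enum_val b)^-1)%g)).
      by rewrite !mxE -/S1 natrX; case: (a == b); rewrite ?mulr1n ?mulr0n; ring.
    rewrite -(eMM Ga) ?groupV // -sumrB mulr_sumr; apply: eq_bigr => w _.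
    by rewrite !chiE; ring.
  have int_f w : f w - 1 \in Aint by rewrite rpredB ?rpred1 ?rpredX ?(Aint_prim_root prim_z).
  have intC : C \is a mxOver Aint.
    apply/mxOverP=> a b; rewrite -[C a b](subrK (((M ^ 2)%:R%:M : 'M_#|G|) a b)) CE.
    rewrite rpredD //; last by rewrite !mxE rpredMn ?rpred_nat.
    by rewrite rpred_sum // => w _; rewrite !rpredM ?Aint_irr.
  have: C \in unitmx.
    apply: (unitmx_eqAmod_scalar (m := (M ^ 2)%:R) (d := 1 - z)) => //.
    - exact: rpred_nat.
    - move=> a b; rewrite /eqAmod CE rpred_sum // => w _.
      rewrite -eqAmod0 -[0](mulr0 ('chi_i (enum_val a * w^-1)^-1%g * 'chi_i (w * (enum_val b)^-1)^-1%g)).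
      by apply: eqAmodMl; rewrite ?rpredM ?Aint_irr // eqAmod0 dvdA_twist.
    rewrite -natrX -expnM unfold_in subr_eq0 eq_sym (negPf z_neq1).
    by apply: contra p'M => /(dvdn_of_Aint_div p_pr prim_z); rewrite Euclid_dvdX // => /andP[].
  by rewrite unitmxZ // unitfE natrX expf_neq0.
(* The relation [Psi A Psi^-1 = z A] forces the trace to vanish, while every diagonal entry of [A]
   is [e g^-1], that is ['chi_i g / M]. *)
have trA : \tr A = 0.
  have trAz : \tr A = z * \tr A.
    rewrite -{1}[A]mul1mx -(mulVmx unitPsi) -mulmxA PsiA -scalemxAr mxtraceZ mxtrace_mulC.
    by rewrite -mulmxA mulmxV // mulmx1.
  apply/eqP; have: (1 - z) * \tr A == 0 by rewrite mulrBl mul1r -trAz subrr.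
  by rewrite mulf_eq0 subr_eq0 eq_sym (negPf z_neq1).
have: \tr A = #|G|%:R * e g^-1%g.
  rewrite /mxtrace (eq_bigr (fun=> e g^-1%g)) ?sumr_const ?card_ord ?mulr_natl // => a _.
  by rewrite mxE mulgV mul1g.
rewrite trA /e invgK => /esym/eqP; rewrite !mulf_eq0 invr_eq0 (negPf M_nz) orbF.
by rewrite (negPf (neq0CG G)) => /eqP.
Qed.

End Vanishing.

(** * Primes with no common codegree *)

(** Truncation is exact here: ['chi_i 1] divides the index of the kernel, being the degree of an
    irreducible character of the quotient. *)
Definition codn (gT : finGroupType) (G : {group gT}) (i : Iirr G) : nat :=
  Num.truncn (codegree i).

(** For distinct primes this says that no codegree is divisible by [p * q]. *)
Definition no_common_cod (gT : finGroupType) (G : {group gT}) (p q : nat) :=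
  forall i : Iirr G, ~~ ((p %| codn i) && (q %| codn i))%N.

Section Codegrees.

Variables (gT : finGroupType) (G : {group gT}).
Implicit Types (i : Iirr G) (p q : nat) (x y : gT).

Lemma codnM i : (codn i)%:R * 'chi_i 1%g = #|G : cfker 'chi_i|%g%:R.
Proof.
have nKG := cfker_normal 'chi_i; set K := cfker_group 'chi_i.
have chi1 : 'chi_(quo_Iirr K i) 1%g = 'chi_i 1%g by rewrite quo_IirrE // cfQuo1.
have /dvdCP[c c_int cE] := dvd_irr1_cardG (quo_Iirr K i).
have {}cE : #|G : K|%g%:R = c * 'chi_i 1%g by rewrite -chi1 -card_quotient ?normal_norm.
have c_ge0 : 0 <= c by rewrite -(pmulr_lge0 _ (irr1_gt0 i)) -cE ler0n.
rewrite /codn /codegree cE mulfK ?irr1_neq0 // truncnK //.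
by have := c_int; rewrite intrEge0.
Qed.

Lemma codegreeE i : codegree i = (codn i)%:R.
Proof. by rewrite /codegree -codnM mulfK ?irr1_neq0. Qed.

Lemma divides_some_codP n :
  reflect (exists i, (n %| codn i)%N) (divides_some_cod G n).
Proof.
apply: (iffP existsP) => -[i ndvd]; exists i; last by rewrite codegreeE dvdC_nat.
by move: ndvd; rewrite codegreeE dvdC_nat.
Qed.

Lemma codn_dvd_index i : (codn i %| #|G : cfker 'chi_i|%g)%N.
Proof.
have := codnM i; rewrite irr1_degree -natrM => /eqP; rewrite eqr_nat => /eqP <-.
exact: dvdn_mulr.
Qed.

Lemma dvdn_codn_cardG n i : (n %| codn i)%N -> (n %| #|G|)%N.
Proof. by move/dvdn_trans; apply; apply: dvdn_trans (codn_dvd_index i) (dvdn_indexg _ _). Qed.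

(** In the quotient by its kernel the character has [p]-defect zero, and the image of [x] there has
    order divisible by [p]. *)
Lemma irr_eq0_of_ndvd_codn p i x :
    prime p -> ~~ (p %| codn i)%N -> x \in G -> (x.`_p)%g \notin cfker 'chi_i ->
  'chi_i x = 0.
Proof.
move=> p_pr p'c Gx Kx; have [sKG nKG] := andP (cfker_normal 'chi_i).
set K := cfker_group 'chi_i; have Nx := subsetP nKG x Gx.
rewrite -cfQuoEker // -quo_IirrE ?cfker_normal //.
apply: (irr_vanish_of_ndvd_order (p := p) (M := codn i)) => //.
- by rewrite quo_IirrE ?cfker_normal // cfQuo1 codnM card_quotient.
- exact: mem_quotient.
apply: contraR Kx => p'x; rewrite -[cfker _]/(gval K) coset_idr ?groupX //.
by rewrite morph_constt //; apply/constt1P; rewrite /p_elt p'natE.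
Qed.

Lemma irr_p_elt_eq0 p i x :
    prime p -> ~~ (p %| codn i)%N -> x \in G -> (p.-elt x)%g -> x \notin cfker 'chi_i ->
  'chi_i x = 0.
Proof. by move=> p_pr p'c Gx px Kx; apply: (irr_eq0_of_ndvd_codn p_pr); rewrite ?constt_p_elt. Qed.

(** Column orthogonality in [G / N] between the trivial coset and that of [y]. *)
Lemma sum_irr1_cfker (N : {group gT}) y : (N <| G)%g -> y \in G ->
  \sum_(i | N \subset cfker 'chi[G]_i) 'chi_i 1%g * ('chi_i y)^* = #|G : N|%g%:R *+ (y \in N).
Proof.
move=> nsNG Gy; have [sNG nNG] := andP nsNG.
transitivity (\sum_j 'chi[G / N]_j 1%g * ('chi_j (coset N y))^*).
  rewrite (reindex _ (mod_Iirr_bij nsNG)) /=.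
  by apply: eq_big => [j|j _]; rewrite mod_IirrE ?cfker_mod // cfMod1 cfModE.
rewrite second_orthogonality_relation ?mem_quotient // cent11T setIT.
rewrite card_quotient //; congr (_ *+ _).
rewrite class_sym class1G inE; congr nat_of_bool; apply/eqP/idP => [yN|]; last exact: coset_id.
by rewrite coset_idr ?(subsetP nNG).
Qed.

(** If [p] divides no codegree, pair the columns of 1 and of an element [x] of order [p]: each term
    is 0 or ['chi_i 1 ^ 2], so a zero sum would kill the term of the trivial character, which is
    1. *)
Lemma vertexP p : prime p -> (exists i, (p %| codn i)%N) <-> (p %| #|G|)%N.
Proof.
move=> p_pr; split=> [[i /dvdn_codn_cardG] // | /(Cauchy p_pr)[x Gx ox]].
apply/existsP; apply: contraT => /existsPn p'cod.
have ntx : x != 1%g by apply: contraTneq (prime_gt1 p_pr) => x1; rewrite -ox x1 order1.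
have px : (p.-elt x)%g by rewrite /p_elt ox pnat_id.
have := second_orthogonality_relation x (group1 G).
rewrite class1G inE (negPf ntx) => /psumr_eq0P sum0.
suffices: 'chi[G]_0 x * ('chi[G]_0 1%g)^* = 0.
  by rewrite irr0 !cfun1E Gx group1 mul1r rmorph1 => /eqP; rewrite oner_eq0.
apply: sum0 => // i _; have [/cfker1-> | Kx] := boolP (x \in cfker 'chi_i).
  exact: mul_conjC_ge0.
by rewrite (irr_p_elt_eq0 p_pr (p'cod i)) ?mul0r.
Qed.

Section NoCommonCodegree.

Variables p q : nat.
Hypotheses (p_pr : prime p) (q_pr : prime q) (neq_pq : p != q).
Hypothesis ncod : no_common_cod G p q.

Variables x y : gT.
Hypotheses (Gx : x \in G) (Gy : y \in G) (px : (p.-elt x)%g) (qy : (q.-elt y)%g).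
Hypothesis ntx : x != 1%g.

(* Both memberships cannot hold, nor both fail: column orthogonality of [x] and
   [y] reads [|G:X| [y \in X] + |G:Y| [x \in Y] = |G:XY|]. *)
Lemma mem_class_gen_xor : (y \in <<x ^: G>>)%g = (x \notin <<y ^: G>>)%g.
Proof.
have nsX z : z \in G -> (<<z ^: G>> <| G)%g.
  by move=> Gz; rewrite /normal gen_subG class_subG ?norms_gen ?class_norm.
have sXK z i : z \in G -> (<<z ^: G>>%g \subset cfker 'chi[G]_i) = (z \in cfker 'chi_i).
  by move=> Gz; rewrite gen_subG class_sub_norm ?cfker_norm.
have not_conj : x \notin (y ^: G)%g.
  apply: contra ntx => /imsetP[z _ xE]; rewrite -order_eq1.
  apply/eqP; apply: pnat_1 px _; rewrite {1}xE orderJ; apply: sub_in_pnat qy => r _ /eqP->.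
  by rewrite !inE eq_sym.
have := second_orthogonality_relation x Gy; rewrite (negPf not_conj) mulr0n.
pose sK z i := <<z ^: G>>%g \subset cfker 'chi[G]_i.
pose XY := (<<x ^: G>> <*> <<y ^: G>>)%G.
have nsXY : (XY <| G)%g by rewrite normalY ?nsX.
(* Inclusion-exclusion on which of [x], [y] lie in the kernel; if neither does, [p] or [q] misses
   the codegree and one of the two values is 0. *)
have -> : \sum_i 'chi[G]_i x * ('chi_i y)^* =
    \sum_(i | sK x i) 'chi_i 1%g * ('chi_i y)^* + \sum_(i | sK y i) 'chi_i x * ('chi_i 1%g)^*
    - \sum_(i | XY \subset cfker 'chi[G]_i) 'chi_i 1%g * ('chi_i 1%g)^*.
  rewrite (big_mkcond (sK x)) (big_mkcond (sK y)) [X in _ - X]big_mkcond.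
  rewrite -big_split -sumrB; apply: eq_bigr => i _ /=.
  rewrite /sK join_subG !sXK //.
  have chi1C : ('chi_i 1%g)^* = 'chi_i 1%g by rewrite irr1_degree rmorph_nat.
  have [Kx|Kx] := boolP (x \in _); have [Ky|Ky] := boolP (y \in _); rewrite /= ?(cfker1 Kx) ?(cfker1 Ky).
  - by rewrite addrK.
  - by rewrite addr0 subr0.
  - by rewrite add0r subr0.
  rewrite addr0 subr0; apply/eqP; rewrite mulf_eq0 conjC_eq0.
  have := ncod i; rewrite negb_and => /orP[p'c | q'c].
    by rewrite (irr_p_elt_eq0 p_pr p'c Gx) ?eqxx.
  by rewrite (irr_p_elt_eq0 q_pr q'c Gy) ?eqxx ?orbT.
have -> : \sum_(i | sK y i) 'chi_i x * ('chi_i 1%g)^* = (#|G : <<y ^: G>>|%g%:R *+ (x \in <<y ^: G>>%g)).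
  apply: (can_inj conjCK); rewrite rmorphMn rmorph_nat -sum_irr1_cfker ?nsX // rmorph_sum.
  by apply: eq_bigr => i _; rewrite rmorphM /= conjCK mulrC.
rewrite !sum_irr1_cfker ?nsX // group1 mulr1n.
have [Yx | Y'x] := boolP (x \in <<y ^: G>>%g); have [Xy | X'y] := boolP (y \in <<x ^: G>>%g) => //.
  have XYeq : <<x ^: G>>%g = <<y ^: G>>%g.
    apply/eqP; rewrite eqEsubset !gen_subG !class_sub_norm ?norms_gen ?class_norm //.
    by rewrite Yx Xy.
  have ->: XY = <<x ^: G>>%G by apply: val_inj; rewrite /= -XYeq; apply/joing_idPl.
  rewrite -XYeq addrK => /eqP; rewrite pnatr_eq0 => /eqP iX0.
  by have := indexg_gt0 G <<x ^: G>>%G; rewrite iX0.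
rewrite addr0 sub0r => /eqP; rewrite oppr_eq0 pnatr_eq0 => /eqP iXY0.
by have := indexg_gt0 G XY; rewrite iXY0.
Qed.

End NoCommonCodegree.

Lemma no_common_cod_sym p q : no_common_cod G p q -> no_common_cod G q p.
Proof. by move=> ncod i; rewrite andbC. Qed.

(** By symmetry [y] may be taken in the normal closure of [x]. In the column orthogonality of
    [x * y] and [x], the term is ['chi_i 1 ^ 2] if [x] is in the kernel, [|'chi_i x|^2] if only [y]
    is, and 0 otherwise; yet the trivial character contributes 1. *)
Lemma no_common_cod_not_commute p q x y :
    prime p -> prime q -> p != q -> no_common_cod G p q ->
    x \in G -> y \in G -> (p.-elt x)%g -> (q.-elt y)%g -> x != 1%g -> y != 1%g ->
  commute x y -> False.
Proof.
move=> p_pr q_pr; wlog Xy: p q p_pr q_pr x y / (y \in <<x ^: G>>%g).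
  move=> IH neq_pq ncod Gx Gy px qy ntx nty cxy.
  have [Xy | X'y] := boolP (y \in <<x ^: G>>%g); first exact: (IH p q _ _ x y).
  apply: (IH q p q_pr p_pr y x) => //; last first.
  - exact: no_common_cod_sym.
  - by rewrite eq_sym.
  apply: contraR X'y.
  by rewrite (mem_class_gen_xor p_pr q_pr neq_pq ncod Gx Gy px qy ntx).
move=> neq_pq ncod Gx Gy px qy ntx nty cxy.
have xyq : ((x * y).`_q)%g = y.
  rewrite consttM // [(y.`_q)%g]constt_p_elt //.
  have /constt1P-> : (q^'.-elt x)%g by apply: sub_in_pnat px => r _ /eqP->; rewrite !inE.
  by rewrite mul1g.
have Gxy := groupM Gx Gy.
have := second_orthogonality_relation (x * y)%g Gx.
have -> : (x * y \in x ^: G)%g = false.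
  apply: contraNF nty => /imsetP[z _ xyE]; rewrite -xyq xyE; apply/eqP/constt1P.
  by rewrite /p_elt orderJ; apply: sub_in_pnat px => r _ /eqP->; rewrite !inE.
move/psumr_eq0P => sum0.
suffices: 'chi[G]_0 (x * y)%g * ('chi[G]_0 x)^* = 0.
  by rewrite irr0 !cfun1E Gx Gxy mul1r rmorph1 => /eqP; rewrite oner_eq0.
apply: sum0 => // i _; have Ky : x \in cfker 'chi[G]_i -> y \in cfker 'chi[G]_i.
  move=> Kx; apply: subsetP Xy; rewrite gen_subG class_sub_norm ?cfker_norm //.
have [Kx | K'x] := boolP (x \in cfker 'chi[G]_i).
  by rewrite cfkerMl // (cfker1 (Ky Kx)) (cfker1 Kx) mul_conjC_ge0.
have [K1y | K'y] := boolP (y \in cfker 'chi[G]_i); first by rewrite cfkerMr // mul_conjC_ge0.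
have := ncod i; rewrite negb_and => /orP[p'c | q'c].
  by rewrite (irr_p_elt_eq0 p_pr p'c Gx) ?conjC0 ?mulr0.
by rewrite (irr_eq0_of_ndvd_codn q_pr q'c Gxy) ?mul0r ?xyq.
Qed.


End Codegrees.

(** * The subgroup generated by the [p]-elements *)

Section ElementsGen.

Local Open Scope group_scope.

Variable gT : finGroupType.
Implicit Types (G H N : {group gT}) (p q r : nat).

(** This is [O^{p'}(G)], the smallest normal subgroup of index prime to [p]. *)
Definition p_elts_gen p G := <<[set x in G | p.-elt x]>>.
Canonical p_elts_gen_group p G := Eval hnf in [group of p_elts_gen p G].

Lemma p_elts_gen_normal p G : p_elts_gen p G <| G.
Proof.
apply/andP; split; first by rewrite gen_subG; apply/subsetP=> x /setIdP[].
apply: norms_gen; apply/subsetP=> x Gx; rewrite inE; apply/subsetP=> _ /imsetP[y /setIdP[Gy py] ->].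
by rewrite inE groupJ // /p_elt orderJ.
Qed.

Lemma mem_p_elts_gen p G x : x \in G -> p.-elt x -> x \in p_elts_gen p G.
Proof. by move=> Gx px; apply: mem_gen; rewrite inE Gx. Qed.

Lemma p_elts_gen_subP p G N :
  reflect (forall x, x \in G -> p.-elt x -> x \in N) (p_elts_gen p G \subset N).
Proof.
rewrite gen_subG; apply: (iffP subsetP) => [sGN x Gx px | sGN x /setIdP[]]; last exact: sGN.
by apply: sGN; rewrite inE Gx.
Qed.

Lemma p_elts_gen_sub_p'index p G N :
  N <| G -> prime p -> ~~ (p %| #|G : N|)%N -> p_elts_gen p G \subset N.
Proof.
move=> /andP[sNG nNG] p_pr p'i; apply/p_elts_gen_subP=> x Gx px.
apply: coset_idr; first exact: (subsetP nNG).
have px' := morph_p_elt (coset_morphism N) (subsetP nNG x Gx) px.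
apply/eqP; rewrite -order_eq1; apply/eqP; apply: pnat_1 px' _.
apply: pnat_dvd (order_dvdG (mem_quotient N Gx)) _.
by rewrite card_quotient // p'natE.
Qed.

Lemma p_elts_gen_p'index p G : prime p -> ~~ (p %| #|G : p_elts_gen p G|)%N.
Proof.
move=> p_pr; have [P sylP] := Sylow_exists p G; have [sPG pP p'P] := and3P sylP.
rewrite -p'natE //; apply: pnat_dvd p'P; apply: indexgS.
by apply/subsetP=> x Px; rewrite mem_p_elts_gen ?(subsetP sPG) ?(mem_p_elt pP).
Qed.

End ElementsGen.

Lemma codn_mod (gT : finGroupType) (G N : {group gT}) (j : Iirr (G / N)) :
  (N <| G)%g -> codn (mod_Iirr j) = codn j.
Proof.
move=> nsNG; rewrite /codn /codegree mod_IirrE // cfMod1.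
have -> : cfker 'chi_j = (cfker ('chi_j %% N)%CF / N)%g.
  by rewrite -cfker_quo ?cfker_mod // cfModK.
by rewrite index_quotient_eq ?cfker_sub ?normal_norm // (setIidPr (normal_sub nsNG)) cfker_mod.
Qed.

Lemma no_common_cod_quo (gT : finGroupType) (G N : {group gT}) p q :
  (N <| G)%g -> no_common_cod G p q -> no_common_cod (G / N) p q.
Proof. by move=> nsNG ncod j; have := ncod (mod_Iirr j); rewrite codn_mod. Qed.

(** * Orienting the pairs of non-adjacent primes *)

Section Arrows.

Local Open Scope group_scope.

Variables (gT : finGroupType) (G : {group gT}).
Implicit Types p q : nat.

Definition arrow p q := (p %| #|G : p_elts_gen q G|)%N.

(** Without an arrow the two subgroups coincide, say with [T]. A chief factor [T / M] then contains
    nontrivial [p]-elements and [q]-elements, and the normal closure of each is all of [T / M],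
    against [mem_class_gen_xor]. *)
Lemma arrow_total p q :
    prime p -> prime q -> p != q -> (p %| #|G|)%N -> no_common_cod G p q ->
  arrow p q || arrow q p.
Proof.
move=> p_pr q_pr neq_pq pG ncod; apply: contraT; rewrite negb_or => /andP[pq qp].
have eqT : p_elts_gen q G = p_elts_gen p G.
  by apply/eqP; rewrite eqEsubset !p_elts_gen_sub_p'index ?p_elts_gen_normal.
set T := p_elts_gen_group p G.
have nsTG : T <| G by apply: p_elts_gen_normal.
have ntT : T :!=: 1.
  apply: contraTneq pG => T1; have := p_elts_gen_p'index G p_pr.
  by rewrite -/(gval T) T1 indexg1.
have [M maxM] : {M : {group gT} | maxnormal M T G}.
  by apply: ex_maxgroup; exists 1%G; rewrite proper1G ntT norms1.
have [/andP[prMT nMG] _] := maxgroupP maxM.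
have nsMG : M <| G by rewrite /normal nMG (subset_trans (proper_sub prMT)) ?normal_sub.
have minTM : minnormal (T / M) (G / M).
  by apply: maxnormal_minnormal; rewrite ?(subset_trans (normal_sub nsTG)) ?normal_norm.
have ex_elt r : prime r -> p_elts_gen r G = T ->
    exists x, [/\ x \in T / M, r.-elt x & x != 1].
  move=> r_pr TrE; have : ~~ (p_elts_gen r G \subset M) by rewrite TrE proper_subn.
  rewrite gen_subG => /subsetPn[x /setIdP[Gx rx] M'x].
  have Nx := subsetP nMG x Gx; exists (coset M x); split.
  - by rewrite mem_quotient // -[gval T]TrE mem_p_elts_gen.
  - exact: (morph_p_elt (coset_morphism M)).
  by apply: contraNneq M'x; apply: coset_idr.
have [x [Tx px ntx]] := ex_elt p p_pr (erefl _).
have [y [Ty qy nty]] := ex_elt q q_pr eqT.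
have sTG : T / M \subset G / M by rewrite quotientS ?normal_sub.
have genE z : z \in T / M -> z != 1 -> <<z ^: (G / M)>> = T / M.
  move=> Tz ntz; have /mingroupP[_ minT] := minTM.
  apply: (minT (<<z ^: (G / M)>>)%G); last by rewrite gen_subG class_sub_norm ?quotient_norms ?normal_norm.
  rewrite norms_gen ?class_norm // andbT -subG1 gen_subG.
  by apply: contra ntz => /subsetP/(_ z (class_refl _ _))/set1P->.
have := mem_class_gen_xor p_pr q_pr neq_pq (no_common_cod_quo nsMG ncod)
  (subsetP sTG x Tx) (subsetP sTG y Ty) px qy ntx.
by rewrite !genE // Tx Ty.
Qed.

(** A [p]-element [x] outside [p_elts_gen q G] is in no normal closure of a [q]-element, so every
    [q]-element is in the normal closure of [x]. *)
Lemma arrow_sub p q :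
    prime p -> prime q -> p != q -> no_common_cod G p q ->
  arrow p q -> p_elts_gen q G \subset p_elts_gen p G.
Proof.
move=> p_pr q_pr neq_pq ncod pq.
have nsT r := p_elts_gen_normal r G.
have /subsetPn[x /setIdP[Gx px] T'x] : ~~ ([set x in G | p.-elt x] \subset p_elts_gen q G).
  apply: contraL pq => sT; have := p_elts_gen_p'index G p_pr; apply: contra => /dvdn_trans; apply.
  by apply: indexgS; rewrite gen_subG.
have ntx : x != 1 by apply: contraNneq T'x => ->.
have sXT (r : nat) z : z \in G -> r.-elt z -> <<z ^: G>> \subset p_elts_gen r G.
  by move=> Gz rz; rewrite gen_subG class_sub_norm ?normal_norm ?nsT ?mem_p_elts_gen.
apply/p_elts_gen_subP=> y Gy qy; apply: (subsetP (sXT p x Gx px)).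
rewrite (mem_class_gen_xor p_pr q_pr neq_pq ncod) //.
by apply: contra T'x; apply: (subsetP (sXT q y Gy qy)).
Qed.

End Arrows.

(** * Fixed-point-free action *)

Import FiniteModule.

Section FixedPointFree.

Local Open Scope group_scope.

Variable gT : finGroupType.
Implicit Types (G H N M P Q R S V Z : {group gT}) (x y h v : gT).

(** If [[h, z] = [h, t]] then [h] commutes with [z t^-1]; injectivity on the finite set [Q] gives
    surjectivity. *)
Lemma commg_imset Q h : h \in 'N(Q) -> {in Q, forall z, commute h z -> z = 1} ->
  {in Q &, injective (fun z => [~ h, z])} /\ [set [~ h, z] | z in Q] = Q.
Proof.
move=> Nh reg_h; have inj : {in Q &, injective (fun z => [~ h, z])}.
  move=> z t Qz Qt /= eq_zt; apply/eqP; rewrite eq_mulgV1; apply/eqP.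
  apply: reg_h; first by rewrite groupM ?groupV.
  apply/commgP/conjg_fixP; rewrite conjgM; apply: (canLR (conjgK _)).
  by apply: (mulgI h^-1); rewrite -!commgEl.
split=> //; apply/eqP; rewrite eqEcard card_in_imset // leqnn andbT.
apply/subsetP=> _ /imsetP[z Qz ->]; rewrite commgEr groupM //.
by rewrite memJ_norm ?groupV ?Nh.
Qed.

(** The sum is invariant under [H], and only 0 is. *)
Lemma actr_sum_eq0 V (abV : abelian V) H (u : fmod_of abV) :
  H \subset 'N(V) -> 'C_V(H) = 1 -> (\sum_(h in H) u ^@ h = 0)%R.
Proof.
move=> nVH regH; set s := (\sum_(h in H) _)%R.
apply: fmod_inj; rewrite fmval0; apply/set1P; rewrite -[[set 1]]regH inE fmodP /=.
apply/centP=> k Hk; apply/commgP/conjg_fixP.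
have Nk := subsetP nVH k Hk.
rewrite -fmvalJ //; congr fmval; rewrite actr_sum /s.
rewrite [RHS](reindex_inj (mulIg k)) /=; apply: eq_big => [h|h Hh]; first by rewrite groupMr.
by rewrite actrM // (subsetP nVH).
Qed.

(* The lines of an elementary abelian group of order [r ^ 2] partition its
   nontrivial elements; summing a vector over all of them counts it [r] extra times. *)
Lemma cyclic_of_fixed_point_free r Z V :
    prime r -> r.-group Z -> abelian Z -> abelian V -> V :!=: 1 -> coprime #|V| r ->
    Z \subset 'N(V) -> {in Z & V, forall h v, h != 1 -> commute h v -> v = 1} ->
  cyclic Z.
Proof.
move=> r_pr rZ abZ abV ntV coVr nVZ regZ.
rewrite (abelian_rank1_cyclic abZ) (rank_pgroup rZ) leqNgt; apply/negP => /p_rank_geP[E].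
case/pnElemP=> sEZ abE logE.
have rE : r.-group E := pgroupS sEZ rZ.
have oE : #|E| = (r ^ 2)%N by rewrite -(part_pnat_id rE) p_part logE.
have r_gt1 := prime_gt1 r_pr.
pose D := [set <[h]>%G | h in E^#].
have ordE h : h \in E^# -> #[h] = r.
  by case/setD1P=> nth Eh; apply: abelem_order_p abE _ _.
have DP L : L \in D -> [/\ L \subset E, #|L| = r & L :!=: 1].
  case/imsetP=> h E1h ->; have /setD1P[nth Eh] := E1h.
  by rewrite /= cycle_subG Eh -orderE ordE // cycle_eq1.
(* Each nontrivial element of [E] lies in exactly one subgroup of [D], the identity in all of
   them. *)
have sumD (M : nmodType) (F : gT -> M) :
    (\sum_(L in D) \sum_(h in L) F h = F 1%g *+ #|D| + \sum_(h in E^#) F h)%R.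
  under eq_bigr => L _ do rewrite (big_setD1 1) ?group1 //=.
  rewrite big_split sumr_const /=; congr (_ + _)%R.
  rewrite (exchange_big_dep (mem E^#)) /= => [|L h /DP[sLE _ _]]; last exact/subsetP/setSD.
  apply: eq_bigr => h E1h; rewrite (big_pred1 <[h]>%G) // => L; apply/andP/eqP => [|->].
    case=> /DP[_ oL _] /setD1P[nth Lh]; apply/esym/val_inj/eqP.
    by rewrite eqEcard /= cycle_subG Lh oL -orderE /= ordE ?leqnn.
  by rewrite /= imset_f // !inE cycle_id andbT; case/setD1P: E1h => ->.
(* The constant function 1 yields [#|D| * r = #|D| + r ^ 2 - 1]. *)
have cardD : #|D| = r.+1.
  have := sumD _ (fun=> 1%N); rewrite sum1_card cardsDS ?sub1G // oE cards1.
  rewrite (eq_bigr (fun=> r)) => [|L /DP[_ oL _]]; last by rewrite sum1_card.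
  rewrite sum_nat_const natn expnS expn1 => eqD.
  apply/eqP; rewrite -(eqn_pmul2r (m := r.-1)) ?(ltn_predRL, r_gt1) //; apply/eqP.
  move: eqD r_gt1; case: (r) => // t; rewrite addrC; nia.
have [v Vv ntv] := trivgPn _ ntV.
have regL (L : {group gT}) : L \subset Z -> L :!=: 1 -> 'C_V(L) = 1.
  move=> sLZ /trivgPn[h Lh nth]; apply/trivgP/subsetP=> w /setIP[Vw /centP cLw].
  by apply/set1P; apply: (regZ h) => //; [apply: (subsetP sLZ) | apply: commute_sym; apply: cLw].
have ntE : E :!=: 1 by rewrite -cardG_gt1 oE (ltn_exp2l 0).
pose u := fmod abV v.
have sum0 (L : {group gT}) : L \subset Z -> L :!=: 1 -> (\sum_(h in L) u ^@ h = 0)%R.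
  by move=> sLZ ntL; rewrite actr_sum_eq0 ?regL // (subset_trans sLZ).
have := sumD _ (actr u); rewrite big1 => [|L /DP[sLE _ ntL]]; last first.
  by rewrite sum0 // (subset_trans sLE).
have := sum0 E sEZ ntE; rewrite (big_setD1 1) //= => /eqP.
rewrite addrC addr_eq0 => /eqP->; rewrite actr1 cardD mulrSr addrK => ur0.
have vr : v ^+ r = 1 by have := congr1 fmval ur0; rewrite fmvalZ fmodK // fmval0.
have: #[v] = 1%N.
  apply/eqP; rewrite -dvdn1 -(eqP coVr) dvdn_gcd order_dvdG //=.
  by rewrite order_dvdn vr.
by move/eqP; rewrite order_eq1 (negPf ntv).
Qed.

(** Sum [u ^@ (h ^ z)] over [z] in [Q] and [h] in [<[x]>]. For fixed [z] this runs over a conjugate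
    of [<[x]>], hence is 0. For fixed [h != 1], [h ^ z = h [h, z]] and [[h, z]] runs over [Q], so it
    is again 0. Only [h = 1] is left, giving [u *+ #|Q| = 0] against coprimality. *)
Lemma no_frobenius_extension V Q x q :
    prime #[x] -> prime q -> q.-group Q -> Q :!=: 1 -> abelian V -> V :!=: 1 -> coprime #|V| q ->
    Q \subset 'N(V) -> x \in 'N(V) -> x \in 'N(Q) ->
    {in Q, forall z, commute x z -> z = 1} ->
    {in V & Q, forall v z, z != 1 -> commute z v -> v = 1} ->
    {in V, forall v, commute x v -> v = 1} -> False.
Proof.
move=> ox_pr q_pr qQ ntQ abV ntV coVq nVQ nVx nQx xQ QV xV.
have [v Vv ntv] := trivgPn _ ntV; pose u := fmod abV v.
have genx h : h \in <[x]> -> h != 1 -> x \in <[h]>.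
  move=> xh nth; suffices ->: <[h]> = <[x]> by apply: cycle_id.
  apply/eqP; rewrite eqEcard cycle_subG xh -!orderE /=.
  have nth1 : #[h] != 1%N by rewrite order_eq1.
  by rewrite (prime_nt_dvdP ox_pr nth1 (order_dvdG xh)).
have commx h y : h \in <[x]> -> h != 1 -> commute h y -> commute x y.
  move=> xh nth chy; have /cycleP[k ->] := genx h xh nth.
  by apply/commute_sym/commuteX/commute_sym.
have nVxs : <[x]> \subset 'N(V) by rewrite cycle_subG.
have sumQ0 : (\sum_(z in Q) \sum_(h in <[x]>) u ^@ (h ^ z) = 0)%R.
  rewrite big1 // => z Qz; have Nz := subsetP nVQ z Qz.
  transitivity (\sum_(h in (<[x]> :^ z)%G) u ^@ h)%R.
    by rewrite [RHS](reindex_inj (conjg_inj z)); apply: eq_bigl => h; rewrite memJ_conjg.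
  apply: actr_sum_eq0.
  - by rewrite /= -(normsP nVQ z Qz) normJ conjSg.
  apply/trivgP/subsetP=> w /setIP[Vw /centP cw]; apply/set1P; apply: (conjg_inj z^-1).
  rewrite conj1g; apply: xV; first by rewrite memJ_norm ?groupV.
  rewrite /commute -[x](conjgK z) -!conjMg.
  by rewrite (cw (x ^ z)) // memJ_conjg cycle_id.
have : (u *+ #|Q| = 0)%R.
  rewrite -sumQ0 exchange_big /= (big_setD1 1) //= [X in (_ + X)%R]big1 => [|h /setD1P[nth xh]].
    by rewrite addr0 -sumr_const; apply: eq_bigr => z _; rewrite conj1g actr1.
  have Nh : h \in 'N(Q) by apply: subsetP xh; rewrite cycle_subG.
  have regh : {in Q, forall z, commute h z -> z = 1}.
    by move=> z Qz /(commx h z xh nth); apply: xQ.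
  have [injQ imQ] := commg_imset Nh regh.
  rewrite (eq_bigr (fun z => (u ^@ h) ^@ [~ h, z])%R) => [|z Qz].
    rewrite -(big_imset (fun k => (u ^@ h) ^@ k)%R injQ) /= imQ actr_sum_eq0 //.
    have [z Qz ntz] := trivgPn _ ntQ.
    apply/trivgP/subsetP=> w /setIP[Vw /centP cw]; apply/set1P.
    by apply: (QV w z Vw Qz ntz); apply/commute_sym/cw.
  rewrite conjg_mulR actrM ?(subsetP nVxs h xh) //.
  by apply: (subsetP nVQ); rewrite -imQ imset_f.
move/(congr1 fmval); rewrite fmvalZ fmodK // fmval0 => vQ.
have: #[v] = 1%N.
  apply/eqP; rewrite -dvdn1; have /eqP <- : coprime #|V| #|Q|.
    by have [n ->] := p_natP qQ; rewrite coprimeXr.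
  by rewrite dvdn_gcd order_dvdG //= order_dvdn vQ.
by move/eqP; rewrite order_eq1 (negPf ntv).
Qed.

(** [R] is a Sylow subgroup of [H :&: N], nontrivial because [#|H : H :&: N| = #|G : N|] is prime to
    [r]; Frattini's argument gives [H = (H :&: N) 'N_H(R)]. *)
Lemma frattini_step G H N r :
    H \subset G -> N <| G -> H * N = G -> prime r -> ~~ (r %| #|G : N|)%N -> (r %| #|H|)%N ->
  exists R, [/\ R \subset H, r.-group R, R :!=: 1 & 'N_H(R) * N = G].
Proof.
move=> sHG /andP[sNG nNG] defG r_pr r'i rH.
have [R sylR] := Sylow_exists r (H :&: N)%G; have [sR rR _] := and3P sylR.
have iHN : #|H : H :&: N| = #|G : N|.
  by rewrite indexgI -defG normC ?(subset_trans sHG) // indexMg.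
exists R; split=> //; first by rewrite (subset_trans sR) ?subsetIl.
  apply: contraL rH => /eqP R1; have := card_Hall sylR; rewrite R1 cards1 => /esym/eqP.
  rewrite p_part_eq1 mem_primes r_pr cardG_gt0 /= => r'HN.
  by rewrite -(LagrangeI H N) Euclid_dvdM // negb_or r'HN -indexgI iHN.
have nsHN : H :&: N <| H by rewrite /normal subsetIl normsI ?normG ?(subset_trans sHG).
have defH := Frattini_arg nsHN sylR.
have nNR : 'N_H(R) \subset 'N(N) by rewrite subIset // (subset_trans sHG).
apply/eqP; rewrite eqEsubset mul_subG ?subIset ?sHG //=.
have: (H :&: N) * 'N_H(R) * N \subset 'N_H(R) * N.
  by rewrite -mulgA (normC nNR) mulgA mulSg // mul_subG ?subsetIr.
by rewrite defH defG.
Qed.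

Lemma dvdn_card_mul_normal G H N p :
  H \subset G -> N <| G -> H * N = G -> (p %| #|G : N|)%N -> (p %| #|H|)%N.
Proof.
move=> sHG /andP[sNG nNG] defG; rewrite -{1}defG normC ?(subset_trans sHG) // indexMg.
by move/dvdn_trans; apply; apply: dvdn_indexg.
Qed.

Lemma mul_normal_sub G H N M : M \subset G -> N \subset M -> H \subset G -> H * N = G -> H * M = G.
Proof.
move=> sMG sNM sHG defG; apply/eqP; rewrite eqEsubset mul_subG //=.
by rewrite -{1}defG mulgS.
Qed.

End FixedPointFree.

(** * The complement graph of a codegree graph *)

Section ArrowConfigurations.

Local Open Scope group_scope.

Variables (gT : finGroupType) (G : {group gT}).
Implicit Types p q r s : nat.

Definition nonadjacent p q := [/\ prime p, prime q, p != q & no_common_cod G p q].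

Lemma nonadjacent_commute p q x y : nonadjacent p q ->
  x \in G -> y \in G -> p.-elt x -> q.-elt y -> x != 1 -> commute x y -> y = 1.
Proof.
case=> p_pr q_pr neq_pq ncod Gx Gy px qy ntx cxy; apply/eqP; apply: contraT => nty.
by case: (no_common_cod_not_commute p_pr q_pr neq_pq ncod Gx Gy px qy ntx nty cxy).
Qed.

(** Two Frattini steps, for [r] in [H] and for [q] in ['N_H(R)]. The second applies because
    [p_elts_gen r G] lies in [p_elts_gen q G], and the arrows supply the divisibility by [q], then
    by [p]. *)
Lemma arrow_chain p q r (H : {group gT}) :
    H \subset G -> H * p_elts_gen r G = G -> (r %| #|H|)%N ->
    nonadjacent p q -> nonadjacent q r -> arrow G p q -> arrow G q r ->
  exists (R Q : {group gT}) x,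
    [/\ R \subset H, r.-group R & R :!=: 1] /\
    [/\ Q \subset H, q.-group Q, Q :!=: 1 & Q \subset 'N(R)] /\
    [/\ x \in H, #[x] = p, x \in 'N(R) & x \in 'N(Q)].
Proof.
move=> sHG defG rH [p_pr q_pr neq_pq ncod_pq] [_ r_pr neq_qr ncod_qr] pq qr.
have nsT t := p_elts_gen_normal t G.
have [R [sRH rR ntR defG1]] := frattini_step sHG (nsT r) defG r_pr (p_elts_gen_p'index G r_pr) rH.
have sN1 : 'N_H(R) \subset G by rewrite subIset ?sHG.
have qN1 := dvdn_card_mul_normal sN1 (nsT r) defG1 qr.
have defG1q := mul_normal_sub (normal_sub (nsT q)) (arrow_sub q_pr r_pr neq_qr ncod_qr qr) sN1 defG1.
have [Q [sQ qQ ntQ defG2]] := frattini_step sN1 (nsT q) defG1q q_pr (p_elts_gen_p'index G q_pr) qN1.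
have sN2 : 'N_('N_H(R))(Q) \subset G by rewrite subIset ?sN1.
have [x /setIP[/setIP[Hx Nx] NQx] ox] := Cauchy p_pr (dvdn_card_mul_normal sN2 (nsT q) defG2 pq).
have [sQH sQN] := subsetIP sQ.
by exists R, Q, x.
Qed.

(** Automorphisms of a cyclic group commute, so the commutator of two elements normalizing [Z] acts
    trivially on it. *)
Lemma commg_cyclic_norm (Z : {group gT}) u x z :
  cyclic Z -> u \in 'N(Z) -> x \in 'N(Z) -> z \in Z -> commute [~ u, x] z.
Proof.
case/cyclicP=> z0 defZ Nu Nx Zz.
have swap w : w \in Z -> w ^ (u * x) = w ^ (x * u).
  have zc : z0 \in Z by rewrite defZ cycle_id.
  have /cycleP[i ui] : z0 ^ u \in <[z0]> by rewrite -defZ memJ_norm.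
  have /cycleP[j xj] : z0 ^ x \in <[z0]> by rewrite -defZ memJ_norm.
  rewrite defZ => /cycleP[k ->].
  by rewrite !conjgM !conjXg ui xj !conjXg ui xj (expgnAC z0 i j).
apply/commute_sym/commgP/conjg_fixP.
have -> : [~ u, x] = (x * u)^-1 * (u * x) by rewrite commgEl conjgE invMg !mulgA.
rewrite conjgM swap ?conjgKV // memJ_norm // groupV groupM //.
Qed.

(** [Q] and [x] act without fixed points on ['Z(R)], and [x] on [Q], which [no_frobenius_extension]
    forbids. *)
Lemma no_arrow_triangle p q r :
    nonadjacent p q -> nonadjacent q r -> nonadjacent p r ->
  arrow G p q -> arrow G q r -> (r %| #|G|)%N -> False.
Proof.
move=> npq nqr npr pq qr rG.
have defG : G * p_elts_gen r G = G by rewrite mulGSid ?normal_sub ?p_elts_gen_normal.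
have [R [Q [x [[sRG rR ntR] [[sQG qQ ntQ nRQ] [Gx ox nRx nQx]]]]]] :=
  arrow_chain (subxx G) defG rG npq nqr pq qr.
have [p_pr q_pr neq_pq _] := npq; have [_ r_pr neq_qr _] := nqr.
have px : p.-elt x by rewrite /p_elt ox pnat_id.
have ntx : x != 1 by rewrite -order_eq1 ox neq_ltn prime_gt1 ?orbT.
have sZR := center_sub R; have rZ := pgroupS sZR rR.
have nZR := gFnorms (@center_igFun) R.
apply: (@no_frobenius_extension _ 'Z(R)%G Q x q) => //.
- by rewrite ox.
- exact: center_abelian.
- by rewrite -(center_nil_eq1 (pgroup_nil rR)) in ntR.
- have [n ->] := p_natP rZ; rewrite coprimeXl // prime_coprime // dvdn_prime2 // eq_sym //.
- by rewrite (subset_trans nRQ).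
- exact: (subsetP nZR).
- move=> z Qz; apply: (nonadjacent_commute npq) => //; first exact: (subsetP sQG).
  exact: mem_p_elt qQ Qz.
- move=> v z Zv Qz; have Rv := subsetP sZR v Zv.
  apply: (nonadjacent_commute nqr); rewrite ?(subsetP sQG z Qz) ?(subsetP sRG v Rv) //.
    exact: mem_p_elt qQ Qz.
  exact: mem_p_elt rR Rv.
move=> v Zv; have Rv := subsetP sZR v Zv.
apply: (nonadjacent_commute npr); rewrite ?(subsetP sRG v Rv) //.
exact: mem_p_elt rR Rv.
Qed.

(** In the tower [S], [R], [Q], [x], the fixed-point-free action of ['Z(R)] on ['Z(S)] makes ['Z(R)]
    cyclic. So for [u != 1] in [Q], [[~ u, x]] is a nontrivial element of [Q] centralizing ['Z(R)],
    against the non-adjacency of [q] and [r]. *)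
Lemma no_arrow_path p q r s :
    nonadjacent p q -> nonadjacent q r -> nonadjacent r s ->
  arrow G p q -> arrow G q r -> arrow G r s -> (s %| #|G|)%N -> False.
Proof.
move=> npq nqr nrs pq qr rs sG.
have [p_pr q_pr neq_pq _] := npq; have [_ r_pr neq_qr _] := nqr.
have [_ s_pr neq_rs ncod_rs] := nrs.
have nsT t := p_elts_gen_normal t G.
have defG : G * p_elts_gen s G = G by rewrite mulGSid ?normal_sub ?nsT.
have [S [sSG sS ntS defGS]] := frattini_step (subxx G) (nsT s) defG s_pr (p_elts_gen_p'index G s_pr) sG.
have sNG : 'N_G(S) \subset G by apply: subsetIl.
have rN := dvdn_card_mul_normal sNG (nsT s) defGS rs.
have defGr := mul_normal_sub (normal_sub (nsT r)) (arrow_sub r_pr s_pr neq_rs ncod_rs rs) sNG defGS.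
have [R [Q [x [[sRN rR ntR] [[sQN qQ ntQ nRQ] [Nx ox nRx nQx]]]]]] :=
  arrow_chain sNG defGr rN npq nqr pq qr.
have [[sRG nSR] sQG] := (subsetIP sRN, subset_trans sQN sNG); have Gx := subsetP sNG x Nx.
have px : p.-elt x by rewrite /p_elt ox pnat_id.
have ntx : x != 1 by rewrite -order_eq1 ox neq_ltn prime_gt1 ?orbT.
have [sZR sZS] := (center_sub R, center_sub S).
have nZR := gFnorms (@center_igFun) R; have nZS := gFnorms (@center_igFun) S.
have ntZR : 'Z(R) != 1 by rewrite (center_nil_eq1 (pgroup_nil rR)).
have ntZS : 'Z(S) != 1 by rewrite (center_nil_eq1 (pgroup_nil sS)).
have cycZ : cyclic 'Z(R).
  apply: (@cyclic_of_fixed_point_free _ r 'Z(R)%G 'Z(S)%G); rewrite ?center_abelian //.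
  - exact: pgroupS sZR rR.
  - have [n ->] := p_natP (pgroupS sZS sS).
    by rewrite coprimeXl // prime_coprime // dvdn_prime2 // eq_sym.
  - by rewrite (subset_trans sZR) // (subset_trans nSR).
  move=> h v Zh Zv; have [Rh Sv] := (subsetP sZR h Zh, subsetP sZS v Zv).
  apply: (nonadjacent_commute nrs); rewrite ?(subsetP sRG h Rh) ?(subsetP sSG v Sv) //.
    exact: mem_p_elt rR Rh.
  exact: mem_p_elt sS Sv.
have [z Zz ntz] := trivgPn _ ntZR; have [u Qu ntu] := trivgPn _ ntQ.
have Qc : [~ u, x] \in Q by rewrite commgEl groupM ?groupV // memJ_norm.
have Rz := subsetP sZR z Zz.
have c1 : [~ u, x] != 1.
  apply: contraNneq ntu => /eqP/commgP/commute_sym cxu; apply/eqP.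
  by apply: (nonadjacent_commute npq Gx _ px _ ntx cxu); [apply: (subsetP sQG) | apply: mem_p_elt qQ Qu].
case/eqP: ntz; apply: (nonadjacent_commute nqr _ _ _ _ c1); rewrite ?(subsetP sQG _ Qc) ?(subsetP sRG z Rz) //.
- exact: mem_p_elt qQ Qc.
- exact: mem_p_elt rR Rz.
by apply: (commg_cyclic_norm cycZ); rewrite ?(subsetP nZR) ?(subsetP nRQ u Qu).
Qed.

End ArrowConfigurations.

Lemma codegree_graph_compl (T : finType) (e : rel T) (gT : finGroupType) (G : {group gT}) :
  simple_graph e -> iso_codegree_graph e G ->
  triangle_free (compl_rel e) /\ three_colorable (compl_rel e).
Proof.
case=> _ e_sym [f [f_inj f_vert f_adj]].
have vertex_f x : cod_vertex G (f x) by apply/f_vert; exists x.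
have f_pr x : prime (f x) by case/andP: (vertex_f x).
have f_dvd x : (f x %| #|G|)%N.
  by have /andP[_ /divides_some_codP[i]] := vertex_f x; apply: dvdn_codn_cardG.
have nonadj x y : compl_rel e x y -> nonadjacent G (f x) (f y).
  case/andP=> neq_xy; rewrite f_adj /cod_adj !vertex_f !(inj_eq f_inj) neq_xy /= => pq'.
  split; rewrite ?(inj_eq f_inj) // => i; apply: contra pq' => fxy.
  apply/divides_some_codP; exists i; rewrite Gauss_dvd //.
  by rewrite prime_coprime // dvdn_prime2 // (inj_eq f_inj).
have csym x y : compl_rel e x y = compl_rel e y x.
  by rewrite /compl_rel eq_sym e_sym.
pose dir x y := compl_rel e x y && arrow G (f x) (f y).
have dirT x y : compl_rel e x y -> dir x y || dir y x.
  move=> cxy; rewrite /dir -(csym x) cxy; have [p_pr q_pr neq_pq ncod] := nonadj x y cxy.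
  exact: arrow_total.
have no_tri x y z : dir x y -> dir y z -> compl_rel e x z -> False.
  move=> /andP[cxy xy] /andP[cyz yz] cxz.
  exact: (no_arrow_triangle (nonadj _ _ cxy) (nonadj _ _ cyz) (nonadj _ _ cxz)).
have no_path x y z t : dir x y -> dir y z -> dir z t -> False.
  move=> /andP[cxy xy] /andP[cyz yz] /andP[czt zt].
  exact: (no_arrow_path (nonadj _ _ cxy) (nonadj _ _ cyz) (nonadj _ _ czt)).
split.
  case=> x [y [z /and3P[cxy cyz cxz]]].
  have [cyx czy czx] : [/\ compl_rel e y x, compl_rel e z y & compl_rel e z x].
    by rewrite ![compl_rel e z _]csym [compl_rel e y x]csym.
  (* Every orientation has two consecutive arrows, the cyclic ones included, and [no_tri] asks for
     no direction on the third pair. *)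
  case/orP: (dirT _ _ cxy) => xy; case/orP: (dirT _ _ cyz) => yz; case/orP: (dirT _ _ cxz) => xz.
  - exact: no_tri xy yz cxz.
  - exact: no_tri xy yz cxz.
  - exact: no_tri xz yz cxy.
  - exact: no_tri xz xy czy.
  - exact: no_tri xy xz cyz.
  - exact: no_tri yz xz cyx.
  - exact: no_tri yz xy czx.
  - exact: no_tri yz xy czx.
pose has_in x := [exists y, dir y x]; pose has_out x := [exists y, dir x y].
(* An arrow from [x] to [y] gives [x] colour 0 or 2 and [y] colour 1 or 2. Both can be 2 only inside
   a path of three arrows. *)
exists (fun x => if ~~ has_in x then inord 0 else if ~~ has_out x then inord 1 else inord 2).
have neq_col x y : dir x y ->
    (if ~~ has_in x then inord 0 else if ~~ has_out x then inord 1 else inord 2 : 'I_3)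
    != (if ~~ has_in y then inord 0 else if ~~ has_out y then inord 1 else inord 2).
  move=> xy; have inY : has_in y by apply/existsP; exists x.
  have outX : has_out x by apply/existsP; exists y.
  rewrite inY outX /= -val_eqE; have [/existsP[w wx] | _] := boolP (has_in x).
    have [/existsP[z yz] | _] := boolP (has_out y); last by rewrite /= !inordK.
    by case: (no_path _ _ _ _ wx xy yz).
  by case: (has_out y); rewrite /= !inordK.
by move=> x y /dirT/orP[] xy; last rewrite eq_sym; apply: neq_col.
Qed.

(** * Codegrees and fixed-point-free action *)

Lemma sum_irr_coset_normal (gT : finGroupType) (G N : {group gT}) (i : Iirr G) h :
    (N <| G)%g -> h \in G -> ~~ (N \subset cfker 'chi_i) ->
  \sum_(n in N) 'chi_i (h * n)%g = 0.
Proof.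
move=> nsNG Gh K'N; have sNG := normal_sub nsNG.
apply: (mulfI (_ : #|G : N|%g%:R != 0)); first by rewrite pnatr_eq0 -lt0n indexg_gt0.
rewrite mulr0 mulr_sumr.
(* The inner sum is the regular character of [G / N], equal to [#|G : N|] on [N] and 0 elsewhere;
   each of its constituents differs from ['chi_i], and generalized orthogonality applies. *)
transitivity (\sum_(n in G) 'chi_i (h * n)%g *
    \sum_(j | N \subset cfker 'chi[G]_j) 'chi_j 1%g * ('chi_j n)^*).
  rewrite [RHS](big_setID N) /= (setIidPr sNG) [X in _ = _ + X]big1 => [|n /setDP[Gn N'n]]; last first.
    by rewrite sum_irr1_cfker // (negPf N'n) mulr0.
  by rewrite addr0; apply: eq_bigr => n Nn; rewrite sum_irr1_cfker ?(subsetP sNG) // Nn mulrC.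
under eq_bigr do rewrite mulr_sumr.
rewrite exchange_big big1 //= => j KjN.
have neq_ij : i != j by apply: contraNneq K'N => ->.
have := generalized_orthogonality_relation h i j.
rewrite (negPf neq_ij) mul0r => /(canRL (mulVKf (neq0CG G))); rewrite mulr0 => sum0.
transitivity ('chi_j 1%g * \sum_(n in G) 'chi_i (n * h)%g * 'chi_j n^-1%g); last by rewrite sum0 mulr0.
rewrite mulr_sumr; apply: eq_bigr => n Gn.
have -> : (h * n = (n * h) ^ n)%g by rewrite conjgE !mulgA mulVg mul1g.
by rewrite cfunJ // irr_inv mulrCA.
Qed.

(** [Q] is only normal modulo the kernel [K]. Since ['chi_i] is constant on cosets of [K], the sum
    over [h Q K] is a nonzero multiple of the sum over [h Q]. *)
Lemma sum_irr_coset (gT : finGroupType) (G Q : {group gT}) (i : Iirr G) h :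
    Q \subset G -> G \subset 'N(Q <*> cfker 'chi_i)%g -> h \in G -> ~~ (Q \subset cfker 'chi_i) ->
  \sum_(u in Q) 'chi_i (h * u)%g = 0.
Proof.
set K := cfker_group 'chi_i => sQG nNG Gh K'Q.
have nsKG : (K <| G)%g := cfker_normal 'chi_i.
have nKQ : Q \subset 'N(K)%g := subset_trans sQG (normal_norm nsKG).
pose N := (Q <*> K)%G; have NE : N = (Q * K)%g :> {set gT} by rewrite /= norm_joinEl.
have nsNG : (N <| G)%g by rewrite /normal nNG join_subG sQG normal_sub.
have K'N : ~~ (N \subset cfker 'chi_i) by rewrite join_subG negb_and K'Q.
have sumN := sum_irr_coset_normal nsNG Gh K'N.
have cardF n : n \in N -> #|[set u in Q | u^-1%g * n \in K]%g| = #|Q :&: K|.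
  rewrite NE => /mulsgP[u0 k0 Qu0 Kk0 ->].
  rewrite -[RHS](card_lcoset _ u0); apply: eq_card => u; rewrite in_set mem_lcoset in_setI.
  rewrite mulgA (groupMr _ Kk0) (groupMl _ (groupVr Qu0)); congr (_ && _).
  by rewrite -groupV invMg invgK.
have: (#|K|%:R * \sum_(u in Q) 'chi_i (h * u)%g == 0).
  have -> : #|K|%:R * \sum_(u in Q) 'chi_i (h * u)%g = #|Q :&: K|%:R * \sum_(n in N) 'chi_i (h * n)%g.
    transitivity (\sum_(u in Q) \sum_(n in N | (u^-1 * n)%g \in K) 'chi_i (h * n)%g).
      rewrite mulr_sumr; apply: eq_bigr => u Qu; rewrite mulr_natl -sumr_const.
      rewrite [RHS](reindex_inj (mulgI u)) /=; apply: eq_big => [k|k Kk].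
        by rewrite mulKg NE andb_idl // => Kk; rewrite mem_mulg.
      by rewrite mulgA (cfkerMr _ Kk).
    rewrite (exchange_big_dep (mem N)) => [|u n _ /andP[] //] /=.
    rewrite mulr_sumr; apply: eq_bigr => n Nn; rewrite sumr_const mulr_natl -(cardF n Nn).
    by congr (_ *+ _); apply: eq_card => u; rewrite in_set [u \in _ in LHS]unfold_in /= Nn.
  by rewrite sumN mulr0.
by rewrite mulf_eq0 (negPf (neq0CG K)) => /eqP.
Qed.

(* Conjugating [h] by [Q] sweeps out the coset [h Q], over which the character sums to 0. *)
Lemma irr_eq0_of_fixed_point_free (gT : finGroupType) (G Q : {group gT}) (i : Iirr G) h :
    Q \subset G -> G \subset 'N(Q <*> cfker 'chi_i)%g -> ~~ (Q \subset cfker 'chi_i) ->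
    h \in G -> h \in 'N(Q)%g -> {in Q, forall z, commute h z -> z = 1%g} ->
  'chi_i h = 0.
Proof.
move=> sQG nNG K'Q Gh Nh regh; have [injQ imQ] := commg_imset Nh regh.
have: #|Q|%:R * 'chi_i h == 0.
  rewrite mulr_natl -sumr_const; apply/eqP; rewrite -[RHS](sum_irr_coset sQG nNG Gh K'Q).
  rewrite -[in RHS]imQ big_imset //=.
  by apply: eq_bigr => z Qz; rewrite -conjg_mulR cfunJ ?(subsetP sQG).
by rewrite mulf_eq0 (negPf (neq0CG Q)) => /eqP.
Qed.

(** ['chi_i] vanishes on [P^#], so its restriction to [P] contains the trivial character
    ['chi_i 1 / #|P|] times and [#|P|] divides the degree. Were [p] to divide the codegree,
    [p * #|P|] would divide [#|G|]. *)
Lemma ndvd_codn_of_fixed_point_free (gT : finGroupType) (G P Q : {group gT}) (i : Iirr G) p :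
    prime p -> (p.-Sylow(G) P)%g -> Q \subset G -> G \subset 'N(Q <*> cfker 'chi_i)%g ->
    ~~ (Q \subset cfker 'chi_i) -> P \subset 'N(Q)%g ->
    {in P & Q, forall h z, h != 1%g -> commute h z -> z = 1%g} ->
  ~~ (p %| codn i)%N.
Proof.
move=> p_pr sylP sQG nNG K'Q nQP regPQ; have sPG := pHall_sub sylP.
have: '['Res[P] 'chi_i, 1] \in Num.nat by rewrite Cnat_cfdot_char ?cfRes_char ?irr_char ?cfun1_char.
rewrite cfdotE (big_setD1 1%g) //= big1 ?addr0 => [|h /setD1P[nth Ph]]; last first.
  rewrite cfResE // (irr_eq0_of_fixed_point_free sQG) ?mul0r ?(subsetP sPG) ?(subsetP nQP) //.
  by move=> z Qz; apply: regPQ.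
rewrite cfResE // cfun1E group1 rmorph1 mulr1 => /natrP[n] /(canRL (mulVKf (neq0CG P))) chi1E.
apply/negP=> /dvdnP[c cE].
have := codnM i; rewrite chi1E cE -!natrM => /eqP; rewrite eqr_nat => /eqP iE.
have: (p * #|P| %| #|G|)%N.
  by apply: dvdn_trans (dvdn_indexg G (cfker_group 'chi_i)); rewrite -iE; apply/dvdnP; exists (c * n)%N; rewrite -!mulnA [(n * _)%N]mulnC !mulnA.
rewrite (card_Hall sylP) -{2}(partnC p (cardG_gt0 G)) mulnC dvdn_pmul2l //.
by apply/negP; rewrite -p'natE ?part_pnat.
Qed.

(** * Primes in arithmetic progressions *)

(** The value is the product of [a - zeta] over the primitive [n]-th roots of unity [zeta], each
    factor of modulus at least [a - 1 > 1]. *)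
Lemma norm_Cyclotomic_gt1 (n a : nat) :
  (0 < n)%N -> (2 < a)%N -> (1 < `|('Phi_n).[a%:Z]|)%N.
Proof.
move=> n_gt0 a_gt2; have [z prim_z] := C_prim_root_exists n_gt0.
have: 1 < `|(('Phi_n).[a%:Z])%:~R| :> algC; last by rewrite -intr_norm -[1]/(1%:~R) ltr_int -ltz_nat.
rewrite -horner_map /= (Cintr_Cyclotomic prim_z) /cyclotomic horner_prod normr_prod.
(* [1 %% n] is an index coprime to [n] even for [n = 1], where it is 0; the product is therefore
   nonempty. *)
have n1 : (1 %% n < n)%N by rewrite ltn_mod.
rewrite (bigD1 (Ordinal n1)) /= ?coprime_modl ?coprime1n //.
have fac k : 1 < `|('X - (z ^+ k)%:P).[(a%:Z)%:~R]| :> algC.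
  rewrite hornerXsubC; apply: lt_le_trans (lerB_dist _ _).
  have /eqP-> : `|z ^+ k| == 1.
    by rewrite -(pexpr_eq1 n_gt0) // -normrX exprAC (prim_expr_order prim_z) expr1n normr1.
  by rewrite -pmulrn normr_nat ltrBrDr -[1 + 1]/(2%:R) ltr_nat.
apply: (lt_le_trans (fac (1 %% n)%N)); rewrite ler_peMr //.
by elim/big_ind: _ => // [x y x_ge1 y_ge1|k _]; [apply: mulr_ege1 | apply/ltW/fac].
Qed.

(** [p] is a prime factor of [Phi_n(a)] for a multiple [a] of [n] and [m!]; as [a ^ n = 1] modulo
    [p], it divides neither. Were the order of [a] less than [n], [a] would be a root of [Phi_n] and
    of another factor [Phi_c] of [X^n - 1], hence a double root, but the derivative [n a^(n-1)] is
    not 0. *)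
Lemma exists_prime_with_root (n m : nat) : (0 < n)%N ->
  exists p g : nat, [/\ prime p, (m < p)%N
    & forall k l, (g ^ k == g ^ l %[mod p])%N = (k == l %[mod n])%N].
Proof.
(* The factor 3 ensures [a > 2]. *)
move=> n_gt0; pose a := (3 * n * m`!)%N.
have a_gt2 : (2 < a)%N by rewrite /a -mulnA leq_pmulr // muln_gt0 n_gt0 fact_gt0.
have [p p_pr p_dvd] := pdivP (norm_Cyclotomic_gt1 n_gt0 a_gt2).
have F0 : (('Phi_n).[a%:Z])%:~R = 0 :> 'F_p.
  have /dvdzP[c ->] : (p %| ('Phi_n).[a%:Z])%Z by rewrite dvdzE.
  by rewrite intrM [X in _ * X]pchar_Fp_0 ?mulr0.
pose q d : {poly 'F_p} := map_poly intr 'Phi_d.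
have qn0 : (q n).[a%:R] = 0 by rewrite -[a%:R]/((a%:Z)%:~R) horner_map.
have prodq d : (0 < d)%N -> \prod_(c <- divisors d) q c = 'X^d - 1.
  by move=> d_gt0; rewrite -rmorph_prod prod_Cyclotomic // rmorphB /= map_polyXn rmorph1.
have an1 : (a%:R : 'F_p) ^+ n = 1.
  apply/eqP; rewrite -subr_eq0; have := congr1 (horner^~ a%:R) (prodq n n_gt0).
  rewrite (big_rem n) ?divisors_id //= hornerM qn0 mul0r => /esym.
  by rewrite !hornerE => ->.
have ap : ~~ (p %| a)%N.
  apply/negP=> pa; have a0 : a%:R = 0 :> 'F_p by apply/eqP; rewrite -(dvdn_pcharf (pchar_Fp p_pr)).
  by have := an1; rewrite a0 expr0n gtn_eqF // => /esym/eqP; rewrite oner_eq0.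
exists p, a; split=> //.
  rewrite ltnNge; apply: contra ap => le_pm; rewrite /a dvdn_mull // dvdn_fact //.
  by rewrite prime_gt0.
have [d prim_a dvd_dn] := prim_order_exists n_gt0 an1.
suffices dn : d = n.
  move=> k l; rewrite -dn -(eq_prim_root_expr prim_a) -!natrX.
  by rewrite -val_eqE /= !val_Fp_nat.
apply/eqP; apply: contraT => neq_dn; have d_gt0 := prim_order_gt0 prim_a.
have: \prod_(c <- divisors d) (q c).[a%:R] == 0.
  by rewrite -horner_prod prodq // !hornerE (prim_expr_order prim_a) subrr.
rewrite prodf_seq_eq0 => /hasP[c /=]; rewrite -dvdn_divisors // => dvd_cd /eqP qc0.
have neq_cn : c != n.
  apply: contraNneq neq_dn => cn; rewrite eqn_dvd dvd_dn.
  by rewrite -{1}cn dvd_cd.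
have := prodq n n_gt0; rewrite (big_rem n) ?divisors_id //= (big_rem c) /=; last first.
  by rewrite rem_mem // -dvdn_divisors // (dvdn_trans dvd_cd).
move/(congr1 (fun P : {poly 'F_p} => (P^`()).[a%:R])).
rewrite derivM derivB derivXn derivC subr0 !(derivM, hornerD, hornerM) qn0 qc0 !(mul0r, mulr0) addr0.
rewrite hornerMn hornerXn -natrX -mulrnA => /esym/eqP; rewrite -(dvdn_pcharf (pchar_Fp p_pr)).
rewrite Euclid_dvdM // Euclid_dvdX // (negPf ap) /= => pn.
by case/negP: ap; rewrite /a -mulnA dvdn_mull // dvdn_mulr.
Qed.

(** * Extension by induced modules *)

Lemma mulrn_eqmod (M : zmodType) (m : M) r k l :
  m *+ r = 0 -> k = l %[mod r] -> m *+ k = m *+ l.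
Proof.
have modE n : m *+ r = 0 -> m *+ n = m *+ (n %% r).
  by move=> mr0; rewrite {1}(divn_eq n r) mulrnDr mulnC mulrnA mr0 mul0rn add0r.
by move=> mr0 eq_kl; rewrite modE // eq_kl -modE.
Qed.

Section FunctionExtension.

Variables (M : finZmodType) (J : finType) (gT : finGroupType).

(** Semidirect product for the action by left translation; one space of functions on [J * gT]
    contains the modules of all indices, cut out below by [equivariant]. *)
Definition fun_ext := ({ffun J * gT -> M} * gT)%type.
HB.instance Definition _ := Finite.on fun_ext.

Definition lshift (b : gT) (v : {ffun J * gT -> M}) : {ffun J * gT -> M} :=
  [ffun z => v (z.1, b^-1 * z.2)%g].

Lemma lshift1 v : lshift 1%g v = v.
Proof. by apply/ffunP=> -[j x]; rewrite ffunE /= invg1 mul1g. Qed.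

Lemma lshiftM b c v : lshift (b * c)%g v = lshift b (lshift c v).
Proof. by apply/ffunP=> -[j x]; rewrite !ffunE /= invMg mulgA. Qed.

Lemma lshiftD b v w : lshift b (v + w) = lshift b v + lshift b w.
Proof. by apply/ffunP=> z; rewrite !ffunE. Qed.

Definition fun_ext_mul (u w : fun_ext) : fun_ext := (u.1 + lshift u.2 w.1, u.2 * w.2)%g.
Definition fun_ext_one : fun_ext := (0, 1%g).
Definition fun_ext_inv (u : fun_ext) : fun_ext := (- lshift u.2^-1%g u.1, u.2^-1%g).

Lemma fun_ext_mulA : associative fun_ext_mul.
Proof. by move=> u v w; rewrite /fun_ext_mul /= lshiftM lshiftD addrA mulgA. Qed.

Lemma fun_ext_mul1 : left_id fun_ext_one fun_ext_mul.
Proof. by case=> v b; rewrite /fun_ext_mul /= lshift1 add0r mul1g. Qed.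

Lemma fun_ext_mulV : left_inverse fun_ext_one fun_ext_inv fun_ext_mul.
Proof. by case=> v b; rewrite /fun_ext_mul /= addNr mulVg. Qed.

HB.instance Definition _ := Finite_isGroup.Build fun_ext fun_ext_mulA fun_ext_mul1 fun_ext_mulV.

Lemma fun_ext_mulE (u w : fun_ext) : (u * w)%g = (u.1 + lshift u.2 w.1, (u.2 * w.2)%g) :> fun_ext.
Proof. by []. Qed.

End FunctionExtension.

Section Layer.

Variables (gT : finGroupType) (B : {group gT}) (J : finType) (r : J -> nat).
Variables (A : J -> {group gT}) (lam : J -> gT -> nat).

Hypotheses (r_pr : forall j, prime (r j)) (r_inj : injective r).
Hypothesis sAB : forall j, A j \subset B.
Hypothesis lamM : forall j, {in A j &, forall a b, lam j (a * b)%g = (lam j a * lam j b)%N %[mod r j]}.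
Hypothesis lam1 : forall j, lam j 1%g = 1 %[mod r j].

(** Values are taken in the cyclic group of order [\prod_j r j], whose [r j]-torsion is the additive
    group of the field of [r j] elements for each [j]. *)
Let N := (\prod_j r j).-1.
Let NE : N.+1 = (\prod_j r j)%N.
Proof. by rewrite prednK // prodn_gt0 // => j; rewrite prime_gt0. Qed.

Let M : finZmodType := 'I_N.+1.
Let gW : finGroupType := fun_ext M J gT.

(** The [j]-th component is the module over the field of [r j] elements induced to [B] from a linear
    character of [A j] with the kernel of [lam j], realized by functions on [B] extended by 0. *)
Definition equivariant (v : {ffun J * gT -> M}) :=
  [forall j, [forall x, [&& (x \notin B) ==> (v (j, x) == 0), v (j, x) *+ r j == 0
    & [forall (a | a \in A j), v (j, x * a)%g == v (j, x) *+ lam j a]]]].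

Let equivP (v : {ffun J * gT -> M}) : reflect (forall j x, [/\ x \notin B -> v (j, x) = 0, v (j, x) *+ r j = 0
    & forall a, a \in A j -> v (j, x * a)%g = v (j, x) *+ lam j a]) (equivariant v).
Proof.
apply: (iffP forallP) => [eqv j x | eqv j].
  have /forallP/(_ x)/and3P[/implyP v0 /eqP vr /forall_inP vA] := eqv j.
  by split=> // [/v0/eqP | a /vA/eqP].
apply/forallP=> x; have [v0 vr vA] := eqv j x.
by apply/and3P; split; [apply/implyP => /v0-> | rewrite vr | apply/forall_inP=> a /vA->].
Qed.

Let equiv0 : equivariant 0.
Proof. by apply/equivP=> j x; split=> [_||a _]; rewrite !ffunE ?mul0rn. Qed.

Let equivD v w : equivariant v -> equivariant w -> equivariant (v + w).
Proof.
move=> /equivP eqv /equivP eqw; apply/equivP=> j x; have [v0 vr vA] := eqv j x.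
have [w0 wr wA] := eqw j x; split=> [B'x||a Aa]; rewrite !ffunE.
- by rewrite v0 ?w0 ?addr0.
- by rewrite mulrnDl vr wr addr0.
by rewrite vA // wA // mulrnDl.
Qed.

Let equiv_lshift b v : b \in B -> equivariant v -> equivariant (lshift b v).
Proof.
move=> Bb /equivP eqv; apply/equivP=> j x; have [v0 vr vA] := eqv j (b^-1 * x)%g.
split=> [B'x||a Aa]; rewrite !ffunE /= ?mulgA ?vA // v0 //.
by rewrite groupMl ?groupV.
Qed.

Definition layer_ext : {set gW} := [set u | equivariant u.1 && (u.2 \in B)].
Definition layer : {set gW} := [set u | equivariant u.1 && (u.2 == 1%g)].

Fact layer_ext_group_set : group_set layer_ext.
Proof.
apply/group_setP; split=> [|[v b] [w c]]; rewrite !inE /= ?equiv0 ?group1 //.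
by move=> /andP[ev Bb] /andP[ew Bc]; rewrite equivD ?equiv_lshift ?groupM.
Qed.
Canonical layer_ext_group := Group layer_ext_group_set.

Fact layer_group_set : group_set layer.
Proof.
apply/group_setP; split=> [|[v b] [w c]]; rewrite !inE /= ?equiv0 ?eqxx //.
by move=> /andP[ev /eqP->] /andP[ew /eqP->]; rewrite lshift1 equivD // mulg1 eqxx.
Qed.
Canonical layer_group := Group layer_group_set.

Definition layer_inj (b : gT) : gW := (0, b).

Lemma layer_injM : {in B &, {morph layer_inj : b c / (b * c)%g}}.
Proof.
move=> b c _ _; rewrite [RHS]fun_ext_mulE; congr (_, _).
by apply/ffunP=> z; rewrite !ffunE addr0.
Qed.
Canonical layer_inj_morphism := Morphism layer_injM.

Lemma injm_layer_inj : ('injm layer_inj)%g.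
Proof. by apply/injmP=> b c _ _ []. Qed.

Lemma layer_abelian : abelian layer.
Proof.
apply/centsP=> -[v b] /[!inE] /andP[_ /= /eqP->] [w c] /[!inE] /andP[_ /= /eqP->].
by rewrite /commute !fun_ext_mulE /= !lshift1 addrC.
Qed.

Lemma layer_sdprod : (layer ><| (layer_inj @* B) = layer_ext)%g.
Proof.
have sW : layer \subset layer_ext.
  by apply/subsetP=> -[v b]; rewrite !inE /= => /andP[-> /eqP->]; rewrite group1.
have sB : (layer_inj @* B)%g \subset layer_ext.
  by apply/subsetP=> _ /morphimP[b _ Bb ->]; rewrite inE /= equiv0.
have nWG : layer_ext \subset 'N(layer)%g.
  apply/subsetP=> u Gu; rewrite inE; apply/subsetP=> _ /imsetP[w Ww ->].
  have /andP[eqv _] : equivariant (w ^ u)%g.1 && ((w ^ u)%g.2 \in B).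
    by have := groupJ (subsetP sW w Ww) Gu; rewrite inE.
  rewrite inE eqv /=; have /andP[_ /eqP w1] : equivariant w.1 && (w.2 == 1%g) by rewrite inE in Ww.
  by rewrite w1 mul1g mulVg.
rewrite sdprodE.
- apply/eqP; rewrite eqEsubset mul_subG //=; apply/subsetP=> -[v b]; rewrite inE /= => /andP[ev Bb].
  apply/mulsgP; exists (v, 1%g) (layer_inj b); rewrite ?inE /= ?ev ?eqxx //.
    exact: mem_morphim.
  by rewrite fun_ext_mulE /= lshift1 addr0 mul1g.
- exact: subset_trans sB nWG.
apply/trivgP/subsetP=> -[v b] /setIP[/[!inE] /andP[_ /= /eqP->]] /morphimP[c _ _ [-> _]].
by apply/eqP.
Qed.

Let ntorsion0 (m : M) a b : m *+ a = 0 -> m *+ b = 0 -> coprime a b -> m = 0.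
Proof.
move=> ma mb co_ab; case: (posnP a) => [a0 | a_gt0].
  by have:= co_ab; rewrite a0 /coprime gcd0n => /eqP b1; rewrite -mb b1.
have [k l kE _] := egcdnP b a_gt0; rewrite (eqP co_ab) in kE.
have : m *+ (k * a) = 0 by rewrite mulnC mulrnA ma mul0rn.
by rewrite kE mulrnDr mulnC mulrnA mb mul0rn add0r.
Qed.

Let layerX (v : {ffun J * gT -> M}) k : (((v, 1%g) : gW) ^+ k)%g = ((v *+ k)%R, 1%g) :> gW.
Proof.
elim: k => [|k IH]; first by rewrite expg0.
by rewrite expgS IH fun_ext_mulE /= lshift1 mul1g mulrS.
Qed.

(** Components with distinct indices have values of coprime orders, so an [r j]-element vanishes off
    the index [j]. *)
Lemma mem_layer_pcore j (u : gW) : u \in 'O_(r j)(layer)%g ->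
  exists2 v, equivariant v /\ (forall i x, i != j -> v (i, x) = 0) & u = (v, 1%g).
Proof.
move=> Ou; have Wu := subsetP (pcore_sub _ _) u Ou.
have : ((r j).-elt u)%g by apply: mem_p_elt (pcore_pgroup _ _) Ou.
case: u Wu {Ou} => v b; rewrite inE => /andP[/= ev /eqP->] rv.
exists v => //; split=> // i x neq_ij; have [_ vr _] := equivP _ ev i x.
have [k ok] := p_natP rv.
apply: (ntorsion0 vr (b := r j ^ k)); last first.
  by rewrite coprimeXr // prime_coprime // dvdn_prime2 // (inj_eq r_inj).
have := layerX v (r j ^ k); rewrite -ok expg_order => -[] /ffunP/(_ (i, x)).
by rewrite ffunE ffunMnE => <-.
Qed.

Lemma layer_pcore_mem j v : equivariant v -> (forall i x, i != j -> v (i, x) = 0) ->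
  ((v, 1%g) : gW) \in 'O_(r j)(layer)%g.
Proof.
move=> ev v0; have Wv : ((v, 1%g) : gW) \in layer by rewrite inE /= ev eqxx.
rewrite (mem_normal_Hall (nilpotent_pcore_Hall _ (abelian_nil layer_abelian))) ?pcore_normal //.
apply: (@pnat_dvd _ (r j)); last by rewrite pnat_id.
rewrite order_dvdn layerX; apply/eqP; congr (_, _); apply/ffunP=> -[i x].
rewrite ffunMnE ffunE; have [->|neq_ij] := eqVneq i j; last by rewrite v0 ?mul0rn.
by have [] := equivP _ ev j x.
Qed.

Lemma layer_commute b v : commute (layer_inj b) ((v, 1%g) : gW) <-> forall j x, v (j, b * x)%g = v (j, x).
Proof.
rewrite /commute !fun_ext_mulE /= lshift1 add0r addr0 mulg1 mul1g; split=> [[vE] j x | vE].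
  by rewrite -[in LHS]vE ffunE /= mulKg.
by congr (_, _); apply/ffunP=> -[j x]; rewrite ffunE /= -[in RHS](mulKVg b x) vE.
Qed.

(** Commutation gives [v x = v (b * x) = v (x * b ^ x)], which is [v x] multiplied by
    [lam j (b ^ x)], an integer that is not 1 modulo [r j]. *)
Lemma layer_reg j b u : b \in B ->
    (forall x, x \in B -> (b ^ x)%g \in A j /\ lam j (b ^ x)%g <> 1 %[mod r j]) ->
  u \in 'O_(r j)(layer)%g -> commute (layer_inj b) u -> u = 1%g.
Proof.
move=> Bb bA /mem_layer_pcore[v [ev v0] ->] /layer_commute vE.
congr (_, _); apply/ffunP=> -[i x]; rewrite ffunE.
have [->|] := eqVneq i j; last exact: v0.
have [vB vr vA] := equivP _ ev j x; have [Bx|/vB //] := boolP (x \in B).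
have [Abx lbx] := bA x Bx; have := vE j x; rewrite [(b * x)%g]conjgC vA // => eqv.
have [l0 | l_gt0] := posnP (lam j (b ^ x)%g); first by rewrite -eqv l0.
apply: (ntorsion0 (a := r j) (b := (lam j (b ^ x)%g).-1)) => //.
  by apply: (addrI (v (j, x))); rewrite addr0 -mulrS prednK.
rewrite prime_coprime //; apply/negP=> dvd_r; apply: lbx.
by rewrite -(prednK l_gt0) -add1n -modnDmr (eqP dvd_r) addn0.
Qed.

Lemma layer_cent j b u : b \in B ->
    (forall x, x \in B -> (b ^ x)%g \in A j /\ lam j (b ^ x)%g = 1 %[mod r j]) ->
  u \in 'O_(r j)(layer)%g -> commute (layer_inj b) u.
Proof.
move=> Bb bA /mem_layer_pcore[v [ev v0] ->]; apply/layer_commute => i x.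
have [->|neq_ij] := eqVneq i j; last by rewrite !v0.
have [vB vr vA] := equivP _ ev j x; have [Bx|B'x] := boolP (x \in B).
  by have [Abx lbx] := bA x Bx; rewrite conjgC vA // (mulrn_eqmod vr lbx).
have [vB' _ _] := equivP _ ev j (b * x)%g.
by rewrite vB // vB' // groupMl.
Qed.

Let r_torsion j : exists2 m : M, m != 0 & m *+ r j = 0.
Proof.
have rN : (r j %| N.+1)%N by rewrite NE (bigD1 j) //= dvdn_mulr.
have r_gt1 := prime_gt1 (r_pr j); have r_gt0 := ltnW r_gt1.
exists (inZp (N.+1 %/ r j)); last first.
  by rewrite Zp_mulrn; apply: val_inj; rewrite /= modnMml divnK // modnn.
by rewrite -val_eqE /= modn_small ?ltn_Pdiv // -lt0n divn_gt0 // dvdn_leq.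
Qed.

(* The induced function [x |-> sum of lam (y x)] over the [y \in <[b]>] with [y x \in A j]. *)
Lemma layer_nreg j b : b \in B -> (<[b]> :&: A j = 1)%g ->
  exists u : gW, [/\ u \in 'O_(r j)(layer)%g, u != 1%g & commute (layer_inj b) u].
Proof.
move=> Bb tibA; have [m m_neq0 mr] := r_torsion j.
pose v : {ffun J * gT -> M} := [ffun z => if z.1 == j then
  \sum_(y in <[b]>%g | (y * z.2)%g \in A j) m *+ lam j (y * z.2)%g else 0].
have sbB : <[b]>%g \subset B by rewrite cycle_subG.
have v0 i x : i != j -> v (i, x) = 0 by move=> neq_ij; rewrite ffunE /= (negPf neq_ij).
have ev : equivariant v.
  apply/equivP=> i x; have [->|neq_ij] := eqVneq i j; last by split=> [||a _]; rewrite ?v0 ?mul0rn.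
  split=> [B'x||a Aa]; rewrite !ffunE /= eqxx.
  - rewrite big1 // => y /andP[by_ Ayx]; case/negP: B'x.
    by rewrite -(groupMl _ (subsetP sbB y by_)) (subsetP (sAB j)).
  - by rewrite -sumrMnl big1 // => y _; rewrite -mulrnA mulnC mulrnA mr mul0rn.
  rewrite -sumrMnl; apply: eq_big => [y|y /andP[_]]; first by rewrite mulgA groupMr.
  rewrite mulgA groupMr // => Ayx.
  by rewrite -mulrnA; apply: mulrn_eqmod mr _; apply: lamM.
exists (v, 1%g); split; first exact: layer_pcore_mem.
  (* Only [y = 1] contributes at the identity, where [v] takes the value [m]. *)
  apply: contra_neq m_neq0 => -[/ffunP/(_ (j, 1%g))]; rewrite !ffunE /= eqxx.
  rewrite (big_pred1 1%g) => [|y]; last first.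
    rewrite mulg1 -in_setI tibA; exact/set1P/eqP.
  by rewrite mulg1 => <-; rewrite (mulrn_eqmod mr (lam1 j)).
apply/layer_commute => i x; have [->|neq_ij] := eqVneq i j; last by rewrite !v0.
rewrite !ffunE /= eqxx [RHS](reindex_inj (mulIg b)) /=; apply: eq_big => y; last by rewrite mulgA.
by rewrite mulgA (groupMr _ (cycle_id b)).
Qed.

Lemma prime_dvd_layer p : prime p -> (p %| #|layer|)%N -> exists j, p = r j.
Proof.
move=> p_pr /(Cauchy p_pr)[[v b]]; rewrite inE => /andP[/= ev /eqP->] ou.
have pv i x : v (i, x) *+ p = 0.
  by have := layerX v p; rewrite -ou expg_order => -[] /ffunP/(_ (i, x)); rewrite ffunE ffunMnE.
apply/exists_eqP; apply: contraT => /existsPn p'r.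
suffices v1 : ((v, 1%g) : gW) = 1%g by move: ou (prime_gt1 p_pr); rewrite v1 order1 => <-.
congr (_, _); apply/ffunP=> -[j x]; rewrite ffunE; have [_ vr _] := equivP _ ev j x.
by apply: (ntorsion0 vr (pv j x)); rewrite prime_coprime // dvdn_prime2 // eq_sym.
Qed.

(** With [A j = B] an equivariant function is determined by its values at 1. These lie in torsion
    subgroups of pairwise coprime orders, so adding them up embeds the layer into a cyclic group. *)
Lemma layer_cyclic : (forall j, A j = B) -> cyclic layer.
Proof.
move=> AB; pose f (u : gW) : 'I_N.+1 := \sum_j u.1 (j, 1%g).
have fM : {in layer &, {morph f : u w / (u * w)%g}}.
  move=> [v b] [w c] /[!inE] /andP[_ /= /eqP->] _; rewrite fun_ext_mulE /f /= lshift1.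
  rewrite -[RHS]/(\sum_j v (j, 1%g) + \sum_j w (j, 1%g)) -big_split.
  by apply: eq_bigr => j _; rewrite ffunE.
have injf : ('injm (Morphism fM))%g.
  apply/subsetP=> -[v b] /morphpreP[/[!inE] /andP[/= ev /eqP->]] /eqP fv0.
  have v1 j : v (j, 1%g) = 0.
    have [_ vr _] := equivP _ ev j 1%g.
    pose c := (\prod_(i | i != j) r i)%N.
    apply: (ntorsion0 vr (b := c)); last first.
      rewrite /c; elim/big_rec: _ => [|i k neq_ij IH]; first exact: coprimen1.
      by rewrite coprimeMr IH andbT prime_coprime // dvdn_prime2 // (inj_eq r_inj) eq_sym.
    have : (f (v, 1%g) : M) *+ c = 0 by rewrite [f _]fv0 mul0rn.
    rewrite /f /= (bigD1 j) //= mulrnDl -[X in _ + X = _]sumrMnl [X in _ + X]big1 ?addr0 // => i neq_ij.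
    have [_ vi _] := equivP _ ev i 1%g.
    by rewrite /c (bigD1 i) //= mulrnA vi mul0rn.
  apply/eqP; congr (_, _); apply/ffunP=> -[j x]; rewrite [RHS]ffunE.
  have [vB _ _] := equivP _ ev j x; have [Bx|/vB //] := boolP (x \in B).
  have [_ _ vA] := equivP _ ev j 1%g.
  by rewrite -[x]mul1g vA ?AB // v1 mul0rn.
rewrite -(injm_cyclic injf) //=; apply: (cyclicS (subsetT _)); apply/cyclicP.
by exists Zp1; apply: Zp_cycle.
Qed.

End Layer.

(** [g] has order [n] modulo [r]. With [x] a generator of [A / K], of order [m], an element of class
    [x ^+ k] is sent to [g ^ (k * (n %/ m))]. *)
Lemma exists_modular_char (gT : finGroupType) (A K : {group gT}) (r g n : nat) :
    (0 < n)%N -> (forall k l, (g ^ k == g ^ l %[mod r])%N = (k == l %[mod n])%N) ->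
    (K <| A)%g -> cyclic (A / K)%g -> (#|A / K|%g %| n)%N ->
  exists lam : gT -> nat,
    {in A &, forall a b, lam (a * b)%g = (lam a * lam b)%N %[mod r]} /\
    {in A, forall a, (lam a == 1 %[mod r])%N = (a \in K)}.
Proof.
move=> n_gt0 gP nsKA /cyclicP[x defAK] mn.
have [sKA nKA] := andP nsKA; pose m := #[x]%g.
have mE : m = #|A / K|%g by rewrite defAK.
have /fin_all_exists[k kE] : forall a, exists k, a \in A -> coset K a = (x ^+ k)%g.
  move=> a; have [Aa|] := boolP (a \in A); last by exists 0%N.
  have: coset K a \in <[x]>%g by rewrite -defAK mem_quotient.
  by case/cycleP=> k ->; exists k.
have nE : n = (m * (n %/ m))%N by rewrite mulnC divnK ?mE.
set q := (n %/ m)%N in nE.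
have q_gt0 : (0 < q)%N by move: n_gt0; rewrite nE muln_gt0 => /andP[].
have scale u v : (u * q == v * q %[mod n])%N = (u == v %[mod m])%N.
  by rewrite nE -!muln_modl eqn_pmul2r.
exists (fun a => g ^ (k a * q))%N; split=> [a b Aa Ab|a Aa] /=.
  apply/eqP; rewrite -expnD gP -mulnDl scale /m -eq_expg_mod_order -kE ?groupM //.
  by rewrite (morphM (coset_morphism K)) ?(subsetP nKA) //= !kE // -expgnDr.
rewrite -[X in (_ == X %[mod _])%N](expn0 g) gP -(mul0n q) scale /m -eq_expg_mod_order.
rewrite -kE // expg0; apply/eqP/idP => [|/coset_id //].
by apply: coset_idr; apply: (subsetP nKA).
Qed.

(* What is used of the extension [H] of [B] by the sum [W] of modules over the fields of
   [r j] elements, the [j]-th one induced from a faithful character of [A j / K j]. *)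
Definition is_layer (gT hT : finGroupType) (B : {group gT}) (J : finType) (r : J -> nat)
    (A K : J -> {group gT}) (H W : {group hT}) (f : {morphism B >-> hT}) : Prop :=
  [/\ ('injm f)%g, (W ><| (f @* B) = H)%g & abelian W] /\
  (forall p, prime p -> (p %| #|W|)%N -> exists j, p = r j) /\
  ((forall j, A j = B) -> cyclic W) /\
  forall j b, b \in B ->
    [/\ (forall x, x \in B -> (b ^ x)%g \in A j :\: K j) ->
          {in 'O_(r j)(W)%g, forall u, commute (f b) u -> u = 1%g},
        (forall x, x \in B -> (b ^ x)%g \in K j) ->
          {in 'O_(r j)(W)%g, forall u, commute (f b) u}
      & (<[b]> :&: A j = 1)%g ->
          exists u, [/\ u \in 'O_(r j)(W)%g, u != 1%g & commute (f b) u]].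

Lemma exists_layer (gT : finGroupType) (B : {group gT}) (J : finType) (r g : J -> nat) (n : nat)
    (A K : J -> {group gT}) :
    (0 < n)%N -> (forall j, prime (r j)) -> injective r ->
    (forall j k l, (g j ^ k == g j ^ l %[mod r j])%N = (k == l %[mod n])%N) ->
    (forall j, A j \subset B) -> (forall j, K j <| A j)%g ->
    (forall j, cyclic (A j / K j)%g) -> (forall j, #|A j / K j|%g %| n)%N ->
  exists (hT : finGroupType) (H W : {group hT}) (f : {morphism B >-> hT}), is_layer r A K H W f.
Proof.
move=> n_gt0 r_pr r_inj gP sAB nsKA cAK dAK.
have /fin_all_exists[lam lamP] j := exists_modular_char n_gt0 (gP j) (nsKA j) (cAK j) (dAK j).
have lamM j := proj1 (lamP j).
have lamK j := proj2 (lamP j).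
have lam1 j : lam j 1%g = 1 %[mod r j] by apply/eqP; rewrite lamK.
exists _, (layer_ext_group B r A lam), (layer_group B r A lam), (layer_inj_morphism B r).
split; first split.
- exact: injm_layer_inj.
- exact: layer_sdprod.
- exact: layer_abelian.
split; first by move=> p; apply: prime_dvd_layer.
split; first by move=> AB; apply: layer_cyclic.
move=> j b Bb; split=> bA.
- move=> u; apply: layer_reg => // x /bA/setDP[Abx K'bx].
  by split=> // /eqP; rewrite lamK // (negPf K'bx).
- move=> u; apply: layer_cent => // x /bA Kbx; have Abx := subsetP (normal_sub (nsKA j)) _ Kbx.
  by split=> //; apply/eqP; rewrite lamK.
exact: layer_nreg.
Qed.

Lemma ndvd_codn_of_Sylow_cfker (gT : finGroupType) (G P : {group gT}) (i : Iirr G) (p : nat) :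
  prime p -> (p.-Sylow(G) P)%g -> P \subset cfker 'chi_i -> ~~ (p %| codn i)%N.
Proof.
move=> p_pr /and3P[_ _ p'i] PK; rewrite -p'natE //; apply: pnat_dvd p'i.
by apply: dvdn_trans (codn_dvd_index i) (indexgS _ PK).
Qed.

(** * Codegrees of a layer extension *)

Section LayerTheory.

Local Open Scope group_scope.

Variables (gT hT : finGroupType) (B : {group gT}) (J : finType) (r : J -> nat).
Variables (A K : J -> {group gT}) (H W : {group hT}) (f : {morphism B >-> hT}).
Hypotheses (r_pr : forall j, prime (r j)) (r'B : forall j, ~~ (r j %| #|B|)%N).
Hypothesis lay : is_layer r A K H W f.

Lemma is_layer_injm : 'injm f. Proof. by case: lay => -[]. Qed.

Lemma is_layer_abelian : abelian W. Proof. by case: lay => -[]. Qed.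

Lemma is_layer_normal : W <| H.
Proof. by case: lay => -[_ /sdprod_context[]]. Qed.

Lemma is_layer_sub : f @* B \subset H.
Proof. by case: lay => -[_ /sdprod_context[]]. Qed.

Lemma is_layer_mul : W * (f @* B) = H.
Proof. by case: lay => -[_ /sdprodW]. Qed.

Lemma is_layer_TI : W :&: (f @* B) = 1.
Proof. by case: lay => -[_ /sdprod_context[]]. Qed.

Lemma card_is_layer : #|H| = (#|W| * #|B|)%N.
Proof.
case: lay => -[injf /sdprod_card <- _] _; congr (_ * _)%N; exact: card_injm.
Qed.

Lemma prime_dvd_is_layer p : prime p -> (p %| #|W|)%N -> exists j, p = r j.
Proof. by case: lay => _ [? _]; auto. Qed.

Lemma is_layer_pcore_normal p : 'O_p(W) <| H.
Proof. exact: gFnormal_trans is_layer_normal. Qed.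

Lemma is_layer_pcore_neq1 j : exists2 u, u \in 'O_(r j)(W) & u != 1.
Proof.
(* The clause on commuting elements, taken at [b = 1], provides a nontrivial element. *)
case: lay => _ [_ [_ /(_ j 1 (group1 B))[_ _ []]]]; last by move=> u [Wu ntu _]; exists u.
by rewrite cycle1; apply/trivgP/subsetIl.
Qed.

Lemma Sylow_is_layer p (P : {group gT}) :
  p.-Sylow(B) P -> ~~ (p %| #|W|)%N -> p.-Sylow(H) (f @* P).
Proof.
move=> sylP p'W; have sPB := pHall_sub sylP.
rewrite pHallE (subset_trans _ is_layer_sub) ?morphimS //= card_injm ?is_layer_injm //.
rewrite card_is_layer partnM ?cardG_gt0 // -(card_Hall sylP) -[X in X == _]mul1n eqn_pmul2r //.
rewrite eq_sym p_part_eq1; apply: contra p'W; rewrite mem_primes; by case/and3P.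
Qed.

Lemma Sylow_is_layer_pcore j : (r j).-Sylow(H) 'O_(r j)(W).
Proof.
rewrite pHallE normal_sub ?is_layer_pcore_normal //=.
rewrite (card_Hall (nilpotent_pcore_Hall _ (abelian_nil is_layer_abelian))) card_is_layer.
rewrite partnM // -[X in X == _]muln1 eqn_pmul2l // eq_sym p_part_eq1.
by apply: contra (r'B j); rewrite mem_primes => /and3P[].
Qed.

(** [W] is generated by its Sylow subgroups, the nontrivial ones being the ['O_(r j)(W)]. *)
Lemma is_layer_sub_group (X : {group hT}) : (forall j, 'O_(r j)(W) \subset X) -> W \subset X.
Proof.
move=> sOX; rewrite -(Sylow_gen W) gen_subG; apply/bigcupsP=> P /SylowP[p p_pr sylP].
have <- : 'O_p(W) = P by apply: normal_Hall_pcore; rewrite // -sub_abelian_normal ?is_layer_abelian ?(pHall_sub sylP).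
have [/(prime_dvd_is_layer p_pr)[j ->] // | p'W] := boolP (p %| #|W|)%N.
have /eqP-> : 'O_p(W) == 1; last exact: sub1G.
rewrite trivg_card1 (card_Hall (nilpotent_pcore_Hall _ (abelian_nil is_layer_abelian))) p_part_eq1.
by apply: contra p'W; rewrite mem_primes => /and3P[].
Qed.

Lemma is_layer_reg j b u : b \in B -> (forall x, x \in B -> b ^ x \in A j :\: K j) ->
  u \in 'O_(r j)(W) -> commute (f b) u -> u = 1.
Proof. by case: lay => _ [_ [_ lj]] Bb bA; have [+ _ _] := lj j b Bb; apply. Qed.

Lemma is_layer_cent j b u : b \in B -> (forall x, x \in B -> b ^ x \in K j) ->
  u \in 'O_(r j)(W) -> commute (f b) u.
Proof. by case: lay => _ [_ [_ lj]] Bb bA; have [_ + _] := lj j b Bb; apply. Qed.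

Lemma is_layer_ex_commute j b : b \in B -> <[b]> :&: A j = 1 ->
  exists u, [/\ u \in 'O_(r j)(W), u != 1 & commute (f b) u].
Proof. by case: lay => _ [_ [_ lj]] Bb bA; have [_ _ +] := lj j b Bb; apply. Qed.

Lemma is_layer_ndvd_codn j p (P : {group gT}) (i : Iirr H) :
    prime p -> p.-Sylow(B) P -> ~~ (p %| #|W|)%N ->
    (forall b, b \in P -> b != 1 -> forall x, x \in B -> b ^ x \in A j :\: K j) ->
    ~~ ('O_(r j)(W) \subset cfker 'chi_i) ->
  ~~ (p %| codn i)%N.
Proof.
move=> p_pr sylP p'W regP K'W; have sPB := pHall_sub sylP.
have nsO := is_layer_pcore_normal (r j); have sylfP := Sylow_is_layer sylP p'W.
apply: (ndvd_codn_of_fixed_point_free p_pr sylfP (normal_sub nsO) _ K'W).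
- by rewrite normsY ?normal_norm ?cfker_normal.
- exact: subset_trans (pHall_sub sylfP) (normal_norm nsO).
move=> _ u /morphimP[b Bb Pb ->] Wu ntfb; apply: is_layer_reg Wu => //; apply: regP => //.
by apply: contraNneq ntfb => ->; rewrite morph1.
Qed.

Lemma is_layer_no_common_cod j p (P : {group gT}) :
    prime p -> p.-Sylow(B) P -> ~~ (p %| #|W|)%N ->
    (forall b, b \in P -> b != 1 -> forall x, x \in B -> b ^ x \in A j :\: K j) ->
  no_common_cod H p (r j).
Proof.
move=> p_pr sylP p'W regP i; rewrite negb_and.
have [KW | K'W] := boolP ('O_(r j)(W) \subset cfker 'chi_i).
  by rewrite (ndvd_codn_of_Sylow_cfker (r_pr j) (Sylow_is_layer_pcore j) KW) orbT.
by rewrite (is_layer_ndvd_codn p_pr sylP p'W regP).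
Qed.

End LayerTheory.

Lemma exists_primes_with_root (J : finType) (n m : nat) : (0 < n)%N ->
  exists r g : J -> nat, injective r /\ forall j, [/\ prime (r j), (m < r j)%N
    & forall k l, (g j ^ k == g j ^ l %[mod r j])%N = (k == l %[mod n])%N].
Proof.
move=> n_gt0; suffices ex_rg k : exists r g : nat -> nat, forall i, (i < k)%N ->
    [/\ prime (r i), (m < r i)%N, (forall j, j < i -> r j < r i)%N
      & forall a b, (g i ^ a == g i ^ b %[mod r i])%N = (a == b %[mod n])%N].
  have [r [g rgP]] := ex_rg #|J|.
  exists (r \o enum_rank), (g \o enum_rank); split=> [x y /= eq_r | j] /=; last first.
    by have [] := rgP _ (ltn_ord (enum_rank j)).
  apply: enum_rank_inj; apply: val_inj => /=.
  have [_ _ rx _] := rgP _ (ltn_ord (enum_rank x)); have [_ _ ry _] := rgP _ (ltn_ord (enum_rank y)).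
  by case: (ltngtP (enum_rank x) (enum_rank y)) => // [/ry | /rx]; rewrite eq_r ltnn.
elim: k => [|k [r [g rgP]]]; first by exists id, id.
(* Starting above the maximum of the earlier primes makes the sequence strictly increasing, hence
   injective. *)
have [q [h [q_pr q_gt hP]]] := exists_prime_with_root (m + \max_(i < k) r i) n_gt0.
exists (fun i => if i == k then q else r i), (fun i => if i == k then h else g i) => i.
rewrite ltnS leq_eqVlt => /predU1P[-> | lt_ik]; last first.
  rewrite ltn_eqF //; have [r_pr r_gt r_lt gP] := rgP i lt_ik; split=> // j lt_ji.
  by rewrite ltn_eqF ?r_lt // (ltn_trans lt_ji).
rewrite eqxx; split=> // [|j lt_jk]; first by rewrite (leq_ltn_trans _ q_gt) ?leq_addr.
rewrite ltn_eqF // (leq_ltn_trans _ q_gt) // (leq_trans _ (leq_addl _ _)) //.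
exact: (leq_bigmax (F := fun i : 'I_k => r i) (Ordinal lt_jk)).
Qed.

(** For adjacency it suffices to exhibit commuting elements: with no common codegree, nontrivial
    elements of the two prime power orders never commute. *)
Lemma iso_codegree_graph_intro (T : finType) (e : rel T) (gT : finGroupType) (G : {group gT}) (f : T -> nat) :
    simple_graph e -> injective f -> (forall x, prime (f x)) -> (forall x, f x %| #|G|)%N ->
    (forall q, prime q -> (q %| #|G|)%N -> exists x, f x = q) ->
    (forall x y, x != y -> ~~ compl_rel e x y -> exists u w,
      [/\ u \in G, w \in G, ((f x).-elt u)%g & ((f y).-elt w)%g] /\ [/\ u != 1%g, w != 1%g & commute u w]) ->
    (forall x y, compl_rel e x y -> no_common_cod G (f x) (f y)) ->
  iso_codegree_graph e G.
Proof.
move=> [e_irr e_sym] f_inj f_pr f_dvd f_surj f_com f_ncod.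
have f_vert x : cod_vertex G (f x).
  by rewrite /cod_vertex f_pr; apply/divides_some_codP/vertexP.
exists f; split=> // [q | x y].
  split=> [/andP[q_pr /divides_some_codP[i /dvdn_codn_cardG]] | [x <-]] //; exact: f_surj.
rewrite /cod_adj !f_vert (inj_eq f_inj) /=.
have [-> | neq_xy] := eqVneq x y; first exact: e_irr.
have co_xy : coprime (f x) (f y) by rewrite prime_coprime // dvdn_prime2 // (inj_eq f_inj).
rewrite /=; have [Dxy | eDxy] := boolP (compl_rel e x y).
  have := Dxy; rewrite /compl_rel neq_xy => /negPf->; apply/esym/divides_some_codP => -[i].
  by rewrite Gauss_dvd // (negPf (f_ncod x y Dxy i)).
have -> : e x y by move: eDxy; rewrite /compl_rel neq_xy negbK.
apply/esym/existsP; apply/existsP; apply: contraT => ndiv.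
have ncod : no_common_cod G (f x) (f y).
  move=> i; apply: contra ndiv => fxy; apply/divides_some_codP; exists i.
  by rewrite Gauss_dvd.
have [u [w [[Gu Gw fu fw] [ntu ntw cuw]]]] := f_com x y neq_xy eDxy.
by case: (no_common_cod_not_commute (f_pr x) (f_pr y) _ ncod Gu Gw fu fw ntu ntw cuw); rewrite (inj_eq f_inj).
Qed.

(** * The two-layer group *)

Definition image_pred (T : finType) (f : T -> nat) (P : pred T) : nat_pred :=
  [pred q | [exists x, P x && (f x == q)]].

Lemma mem_image_pred (T : finType) (f : T -> nat) (P : pred T) x :
  injective f -> (f x \in image_pred f P) = P x.
Proof.
move=> f_inj; apply/existsP/idP => [[y /andP[Py /eqP/f_inj <-]] // | Px].
by exists x; rewrite Px eqxx.
Qed.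

Section TwoLayers.

Local Open Scope group_scope.

Variables (T : finType) (D : rel T) (col p r1 r2 : T -> nat).
Hypothesis D_tri : forall x y z, D x y -> D y z -> D x z -> False.
Hypotheses (p_pr : forall x, prime (p x)) (p_inj : injective p).
Hypotheses (r1_pr : forall x, prime (r1 x)) (r1_inj : injective r1).
Hypotheses (r2_pr : forall x, prime (r2 x)) (r2_inj : injective r2).

Definition miss0 d := image_pred p (fun o => (col o == 0%N) && ~~ D o d).
Definition hit0 i := image_pred p (fun o => (col o == 0%N) && D o i).
Definition miss1 i := image_pred r1 (fun d => (col d == 1%N) && ~~ D d i).

Variables (gT0 gT1 : finGroupType) (T0 : {group gT0}).
Hypothesis cycT0 : cyclic T0.
Hypothesis p_T0 : forall x, col x = 0%N -> (p x %| #|T0|)%N.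
Hypothesis T0_p : forall q, prime q -> (q %| #|T0|)%N -> exists2 x, col x = 0%N & q = p x.
Hypothesis r1_gt : forall x, (#|T0| < r1 x)%N.

(** Kernel of the action of [T0] on the Sylow [r1 d]-subgroup of the first layer [C]. *)
Definition K1 d := 'O_(miss0 d)(T0)%G.

Variables (H1 C : {group gT1}) (f1 : {morphism T0 >-> gT1}).
Hypothesis lay1 : is_layer (fun j : {x | col x == 1%N} => r1 (val j)) (fun=> T0)
  (fun j => K1 (val j)) H1 C f1.

Let ind k x (colx : col x = k) : {x | col x == k} := exist _ x (introT eqP colx).

Let abT0 : abelian T0 := cyclic_abelian cycT0.

Let r1'T0 x : ~~ (r1 x %| #|T0|)%N.
Proof. by rewrite gtnNdvd. Qed.

Let prime_dvd_C q : prime q -> (q %| #|C|)%N -> exists2 x, col x = 1%N & q = r1 x.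
Proof. by move=> q_pr /(prime_dvd_is_layer lay1 q_pr)[[x /= /eqP colx] ->]; exists x. Qed.

Let co_C_T0 : coprime #|C| #|T0|.
Proof.
apply: (@pnat_coprime [pred q | #|T0| < q]%N).
  by apply/pnatP=> // q q_pr /(prime_dvd_C q_pr)[x _ ->]; rewrite inE.
by apply/pnatP=> // q q_pr qT; rewrite !inE -leqNgt dvdn_leq.
Qed.

Let p'C x : col x = 0%N -> ~~ (p x %| #|C|)%N.
Proof.
move=> colx; apply/negP=> /(prime_dvd_C (p_pr x))[y _ pE].
by have := r1_gt y; rewrite -pE ltnNge dvdn_leq // p_T0.
Qed.

Let cycC : cyclic C.
Proof. by case: lay1 => _ [_ [+ _]]; apply. Qed.

Let nsCH1 : C <| H1 := is_layer_normal lay1.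

Definition A2 i := (C <*> f1 @* 'O_(hit0 i)(T0))%G.
Definition K2 i := 'O_(miss1 i)(C)%G.

Let sub_f1 (X : {set gT0}) : X \subset T0 -> f1 @* X \subset H1.
Proof. by move=> sX; apply: subset_trans (morphimS f1 sX) (is_layer_sub lay1). Qed.

Lemma K2_normal i : K2 i <| H1.
Proof. exact: gFnormal_trans nsCH1. Qed.

Lemma A2_normal i : A2 i <| H1.
Proof.
apply/andP; split; first by rewrite join_subG normal_sub // sub_f1 ?pcore_sub.
rewrite -(is_layer_mul lay1); apply: mul_subG; first exact: subset_trans (joing_subl _ _) (normG _).
apply: normsY; last by apply: morphim_norms; apply: gFnorm.
exact: subset_trans (is_layer_sub lay1) (normal_norm nsCH1).
Qed.

Lemma K2_A2_normal i : K2 i <| A2 i.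
Proof.
apply: normalS (K2_normal i); last exact: normal_sub (A2_normal i).
exact: subset_trans (pcore_sub _ _) (joing_subl _ _).
Qed.

Lemma pcore_sub_K2 d i : col d = 1%N -> ~~ D d i -> 'O_(r1 d)(C) \subset K2 i.
Proof.
by move=> cold Ddi; apply: sub_pcore => q /eqP->; rewrite mem_image_pred ?cold.
Qed.

(** [C] and [X] are cyclic of coprime orders, so it is enough that they commute modulo [K2 i]. The
    Sylow [r1 d]-subgroup of [C] lies in [K2 i] unless [D d i]; in that case no colour-0 neighbour
    of [i] is a neighbour of [d], as there are no triangles, so [X] centralizes it. *)
Lemma A2_K2_cyclic i : cyclic (A2 i / K2 i).
Proof.
set X := f1 @* 'O_(hit0 i)(T0).
have sXH : X \subset H1 by rewrite sub_f1 ?pcore_sub.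
have nKX : X \subset 'N(K2 i) := subset_trans sXH (normal_norm (K2_normal i)).
have nKC : C \subset 'N(K2 i) := subset_trans (normal_sub nsCH1) (normal_norm (K2_normal i)).
have nCX : X \subset 'N(C) := subset_trans sXH (normal_norm nsCH1).
have cycX : cyclic X by rewrite morphim_cyclic // (cyclicS (pcore_sub _ _)).
have -> : A2 i / K2 i = (C / K2 i) * (X / K2 i).
  by rewrite /= norm_joinEr // quotientMl.
apply: cyclicM; rewrite ?quotient_cyclic //.
  have sC : C \subset (K2 i <*> 'C_H1(X))%G.
    apply: (is_layer_sub_group lay1) => -[d /= /eqP cold].
    have [Ddi | D'di] := boolP (D d i); last by rewrite (subset_trans (pcore_sub_K2 cold D'di)) ?joing_subl.
    apply: subset_trans (joing_subr _ _); rewrite subsetI; apply/andP; split.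
      exact: subset_trans (pcore_sub _ _) (normal_sub nsCH1).
    rewrite centsC; apply/centsP=> _ /morphimP[b T0b Ob ->] u Wu.
    apply: (is_layer_cent lay1 (j := ind cold)) => // x T0x.
    have -> : b ^ x = b by apply/conjg_fixP/commgP; apply: (centsP abT0).
    apply: subsetP Ob; apply: sub_pcore => q /existsP[o /andP[/andP[/eqP colo Doi] /eqP <-]].
    rewrite mem_image_pred // colo /=; apply/negP=> Dod; exact: D_tri Dod Ddi Doi.
  rewrite centsC; apply: subset_trans (quotientS _ sC) _.
  rewrite /= quotientYidl; last by rewrite subIset // normal_norm ?K2_normal.
  exact: subset_trans (quotientS _ (subsetIr _ _)) (quotient_cent _ _).
apply: coprime_dvdl (dvdn_quotient _ _) _; apply: coprime_dvdr (dvdn_quotient _ _) _.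
apply: coprime_dvdr co_C_T0; rewrite card_injm ?(is_layer_injm lay1) ?pcore_sub //.
by rewrite cardSg ?pcore_sub.
Qed.

Lemma card_A2_K2_dvdn i : (#|A2 i / K2 i| %| #|T0| * #|C|)%N.
Proof.
rewrite mulnC -(card_is_layer lay1); apply: dvdn_trans (dvdn_quotient _ _) _.
by rewrite cardSg ?normal_sub ?A2_normal.
Qed.

Variables (gT2 : finGroupType) (G W : {group gT2}) (f2 : {morphism H1 >-> gT2}).
Hypothesis r2_gt : forall x, (#|H1| < r2 x)%N.
Hypothesis lay2 : is_layer (fun j : {x | col x == 2%N} => r2 (val j)) (fun j => A2 (val j))
  (fun j => K2 (val j)) G W f2.
Hypothesis col_lt3 : forall x, (col x < 3)%N.

Let r2'H1 x : ~~ (r2 x %| #|H1|)%N.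
Proof. by rewrite gtnNdvd. Qed.

Let prime_dvd_W q : prime q -> (q %| #|W|)%N -> exists2 x, col x = 2%N & q = r2 x.
Proof. by move=> q_pr /(prime_dvd_is_layer lay2 q_pr)[[x /= /eqP colx] ->]; exists x. Qed.

Let H1'W q : prime q -> (q %| #|H1|)%N -> ~~ (q %| #|W|)%N.
Proof.
move=> q_pr qH; apply/negP=> /(prime_dvd_W q_pr)[x _ qE].
by have := r2_gt x; rewrite -qE ltnNge dvdn_leq.
Qed.

Let prime_dvd_pcore (rT : finGroupType) (X : {group rT}) (q : nat) u :
  u \in 'O_q(X) -> u != 1 -> (q %| #|X|)%N.
Proof.
move=> Ou ntu; have ntO : 'O_q(X) != 1 by apply/trivgPn; exists u.
have [_ qO _] := pgroup_pdiv (pcore_pgroup q X) ntO.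
exact: dvdn_trans qO (cardSg (pcore_sub _ _)).
Qed.

Let r1_C x : col x = 1%N -> (r1 x %| #|C|)%N.
Proof. by move=> colx; have [u Ou ntu] := is_layer_pcore_neq1 lay1 (ind colx); apply: prime_dvd_pcore Ou ntu. Qed.

Let r2_W x : col x = 2%N -> (r2 x %| #|W|)%N.
Proof. by move=> colx; have [u Ou ntu] := is_layer_pcore_neq1 lay2 (ind colx); apply: prime_dvd_pcore Ou ntu. Qed.

Let p_H1 x : col x = 0%N -> (p x %| #|H1|)%N.
Proof. by move=> colx; rewrite (card_is_layer lay1) dvdn_mull ?p_T0. Qed.

Let r1_H1 x : col x = 1%N -> (r1 x %| #|H1|)%N.
Proof. by move=> colx; rewrite (card_is_layer lay1) dvdn_mulr ?r1_C. Qed.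

Let Sylow_T0 x : (p x).-Sylow(T0) 'O_(p x)(T0).
Proof. exact: nilpotent_pcore_Hall (abelian_nil abT0). Qed.

Let Sylow_f1 x : col x = 0%N -> (p x).-Sylow(H1) (f1 @* 'O_(p x)(T0)).
Proof. by move=> colx; apply: (Sylow_is_layer lay1) (Sylow_T0 x) (p'C colx). Qed.

Let Sylow_C x : col x = 1%N -> (r1 x).-Sylow(H1) 'O_(r1 x)(C).
Proof. by move=> colx; apply: (Sylow_is_layer_pcore _ lay1 (ind colx)) => j; apply: r1'T0. Qed.

Let p_elt_disjoint (rT : finGroupType) (u : rT) (q : nat) (pi : nat_pred) :
  q.-elt u -> pi.-elt u -> q \notin pi -> u = 1.
Proof.
move=> qu piu pi'q; apply/eqP; rewrite -order_eq1; apply/eqP; apply: pnat_1 qu _.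
by apply: sub_in_pnat piu => t _ pit; rewrite !inE; apply: contraNneq pi'q => <-.
Qed.

Let reg_f1 o i : col o = 0%N -> D o i -> forall b, b \in f1 @* 'O_(p o)(T0) -> b != 1 ->
  forall x, x \in H1 -> b ^ x \in A2 i :\: K2 i.
Proof.
move=> colo Doi b fOb ntb x Hx.
rewrite inE !memJ_norm ?(subsetP (normal_norm (K2_normal i))) ?(subsetP (normal_norm (A2_normal i))) //.
apply/andP; split.
  apply: contra ntb => Kb.
  suffices: b \in C :&: (f1 @* T0) by rewrite (is_layer_TI lay1) => /set1P->.
  rewrite inE.
  rewrite (subsetP (pcore_sub _ _) _ Kb) /=; apply: subsetP fOb; exact: morphimS (pcore_sub _ _).
apply: (subsetP (joing_subr _ _)); apply: subsetP fOb; apply: morphimS; apply: sub_pcore => q /eqP->.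
by rewrite mem_image_pred // colo.
Qed.

Let reg_C d i : col d = 1%N -> D d i -> forall b, b \in 'O_(r1 d)(C) -> b != 1 ->
  forall x, x \in H1 -> b ^ x \in A2 i :\: K2 i.
Proof.
move=> cold Ddi b Ob ntb x Hx.
rewrite inE !memJ_norm ?(subsetP (normal_norm (K2_normal i))) ?(subsetP (normal_norm (A2_normal i))) //.
apply/andP; split; last exact: (subsetP (joing_subl _ _)) (subsetP (pcore_sub _ _) _ Ob).
apply: contra ntb => Kb; apply/eqP.
apply: (p_elt_disjoint (mem_p_elt (pcore_pgroup _ _) Ob) (mem_p_elt (pcore_pgroup _ _) Kb)).
by rewrite mem_image_pred // cold Ddi.
Qed.

Lemma no_common_cod_02 o i : col o = 0%N -> col i = 2%N -> D o i -> no_common_cod G (p o) (r2 i).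
Proof.
move=> colo coli Doi.
apply: (is_layer_no_common_cod (r := fun j : {x | col x == 2%N} => r2 (val j)) _ _ lay2
  (j := ind coli) (p_pr o) (Sylow_f1 colo)) => //; last exact: reg_f1.
by apply: H1'W; rewrite ?p_H1.
Qed.

Lemma no_common_cod_12 d i : col d = 1%N -> col i = 2%N -> D d i -> no_common_cod G (r1 d) (r2 i).
Proof.
move=> cold coli Ddi.
apply: (is_layer_no_common_cod (r := fun j : {x | col x == 2%N} => r2 (val j)) _ _ lay2
  (j := ind coli) (r1_pr d) (P := 'O_(r1 d)(C)%G) (Sylow_C cold)) => //; last exact: reg_C.
by apply: H1'W; rewrite ?r1_H1.
Qed.

Let commute_C_W d i u w : col d = 1%N -> col i = 2%N -> ~~ D d i ->
  u \in 'O_(r1 d)(C) -> w \in 'O_(r2 i)(W) -> commute (f2 u) w.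
Proof.
move=> cold coli D'di Ou Ww.
have Ku := subsetP (pcore_sub_K2 cold D'di) u Ou.
have Hu := subsetP (normal_sub (K2_normal i)) u Ku.
apply: (is_layer_cent lay2 (j := ind coli)) => // x Hx.
by rewrite memJ_norm // (subsetP (normal_norm (K2_normal i))).
Qed.

(* If some [W_i] outside the kernel is moved by the Sylow [r1 d]-subgroup [Q], then
   [r1 d] does not divide the codegree; otherwise [Q] is normal modulo the kernel. *)
Lemma no_common_cod_01 o d : col o = 0%N -> col d = 1%N -> D o d -> no_common_cod G (p o) (r1 d).
Proof.
move=> colo cold Dod i; rewrite negb_and.
have pW := H1'W (p_pr o) (p_H1 colo); have r1W := H1'W (r1_pr d) (r1_H1 cold).
have nsO : 'O_(r1 d)(C) <| H1 := is_layer_pcore_normal lay1 (r1 d).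
pose Q := (f2 @* 'O_(r1 d)(C))%G.
have [/existsP[j /andP[Ddj K'W]] | /existsPn KW] := boolP [exists j : {x | col x == 2%N},
    D d (val j) && ~~ ('O_(r2 (val j))(W) \subset cfker 'chi_i)].
  rewrite (is_layer_ndvd_codn lay2 (r1_pr d) (P := 'O_(r1 d)(C)%G) (Sylow_C cold) r1W _ K'W) ?orbT //.
  exact: reg_C.
have [KQ | K'Q] := boolP (Q \subset cfker 'chi_i).
  rewrite (ndvd_codn_of_Sylow_cfker (r1_pr d) (P := Q) _ KQ) ?orbT //.
  exact: (Sylow_is_layer lay2 (P := 'O_(r1 d)(C)%G)) (Sylow_C cold) r1W.
have sQG : Q \subset G by apply: subset_trans (morphimS _ (normal_sub nsO)) (is_layer_sub lay2).
have nKG := normal_norm (cfker_normal 'chi_i).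
have nQH : f2 @* H1 \subset 'N(Q) by apply: morphim_norms; apply: normal_norm.
have sPH := pHall_sub (Sylow_f1 colo).
rewrite (ndvd_codn_of_fixed_point_free (p_pr o) (P := (f2 @* (f1 @* 'O_(p o)(T0)))%G)
  (Sylow_is_layer lay2 (Sylow_f1 colo) pW) sQG _ K'Q) //.
(* [W] normalizes [Q] modulo the kernel: each ['O_(r2 j)(W)] lies in the kernel or, when [d] and [j]
   are not joined by [D], commutes with [Q]. *)
- apply: subset_trans (_ : G \subset W * (f2 @* H1)) _; first by rewrite (is_layer_mul lay2).
  apply: mul_subG; last first.
    by apply: normsY => //; apply: subset_trans (is_layer_sub lay2) nKG.
  apply: (is_layer_sub_group lay2 (X := 'N(Q <*> cfker 'chi_i)%G)) => -[j coljb].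
  have colj := eqP coljb; have := KW (exist _ j coljb); rewrite negb_and negbK /=.
  have sWG : 'O_(r2 j)(W) \subset G.
    exact: subset_trans (pcore_sub _ _) (normal_sub (is_layer_normal lay2)).
  case/orP=> [D'dj | KWj]; last by rewrite (subset_trans KWj) ?(subset_trans (joing_subr _ _) (normG _)).
  apply: normsY; last exact: subset_trans sWG nKG.
  apply: cents_norm; apply/centsP=> w Ww _ /morphimP[u Hu Ou ->].
  exact/commute_sym/(commute_C_W cold colj D'dj).
- exact: subset_trans (morphimS _ sPH) nQH.
move=> _ _ /morphimP[b Hb Pb ->] /morphimP[u Hu Ou ->] ntfb cbu.
have {}cbu : commute b u.
  by apply: (injmP (is_layer_injm lay2)); rewrite ?groupM // !morphM.
suffices -> : u = 1 by rewrite morph1.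
case/morphimP: Pb => b0 T0b Ob bE; rewrite bE in cbu.
apply: (is_layer_reg lay1 (j := ind cold) T0b) => // x T0x.
have -> : b0 ^ x = b0 by apply/conjg_fixP/commgP; apply: (centsP abT0).
rewrite inE T0b andbT; apply: contra ntfb => Kb; rewrite bE.
rewrite (p_elt_disjoint (mem_p_elt (pcore_pgroup _ _) Ob) (mem_p_elt (pcore_pgroup _ _) Kb)) ?morph1 //.
by rewrite mem_image_pred // colo Dod.
Qed.

Definition layer_prime x := if col x == 0%N then p x else if col x == 1%N then r1 x else r2 x.

Let col_cases x : [\/ col x = 0%N, col x = 1%N | col x = 2%N].
Proof. by have := col_lt3 x; case: (col x) => [|[|[|]]] // _; [constructor 1 | constructor 2 | constructor 3]. Qed.

Let layer_prime0 x : col x = 0%N -> layer_prime x = p x.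
Proof. by rewrite /layer_prime => ->. Qed.

Let layer_prime1 x : col x = 1%N -> layer_prime x = r1 x.
Proof. by rewrite /layer_prime => ->. Qed.

Let layer_prime2 x : col x = 2%N -> layer_prime x = r2 x.
Proof. by rewrite /layer_prime => ->. Qed.

Lemma layer_prime_prime x : prime (layer_prime x).
Proof. by rewrite /layer_prime; do 2?case: ifP. Qed.

Let cardG2 : #|G| = (#|W| * (#|C| * #|T0|))%N.
Proof. by rewrite (card_is_layer lay2) (card_is_layer lay1). Qed.

Lemma layer_prime_dvd x : (layer_prime x %| #|G|)%N.
Proof.
rewrite cardG2; case: (col_cases x) => colx.
- by rewrite layer_prime0 // !dvdn_mull ?p_T0.
- by rewrite layer_prime1 // dvdn_mull ?dvdn_mulr ?r1_C.
by rewrite layer_prime2 // dvdn_mulr ?r2_W.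
Qed.

Lemma layer_prime_surj q : prime q -> (q %| #|G|)%N -> exists x, layer_prime x = q.
Proof.
move=> q_pr; rewrite cardG2 !Euclid_dvdM // => /or3P[].
- by case/(prime_dvd_W q_pr)=> x colx ->; exists x; apply: layer_prime2.
- by case/(prime_dvd_C q_pr)=> x colx ->; exists x; apply: layer_prime1.
by case/(T0_p q_pr)=> x colx ->; exists x; apply: layer_prime0.
Qed.

Let p_lt_r1 x y : col x = 0%N -> (p x < r1 y)%N.
Proof. by move=> colx; apply: leq_ltn_trans (r1_gt y); rewrite dvdn_leq ?p_T0. Qed.

Let p_lt_r2 x y : col x = 0%N -> (p x < r2 y)%N.
Proof. by move=> colx; apply: leq_ltn_trans (r2_gt y); rewrite dvdn_leq ?p_H1. Qed.

Let r1_lt_r2 x y : col x = 1%N -> (r1 x < r2 y)%N.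
Proof. by move=> colx; apply: leq_ltn_trans (r2_gt y); rewrite dvdn_leq ?r1_H1. Qed.

Lemma layer_prime_inj : injective layer_prime.
Proof.
have neq x y : (col x < col y)%N -> layer_prime x != layer_prime y.
  case: (col_cases x) (col_cases y) => colx [] coly; rewrite colx coly // => _; rewrite neq_ltn.
  - by rewrite layer_prime0 // layer_prime1 // p_lt_r1.
  - by rewrite layer_prime0 // layer_prime2 // p_lt_r2.
  by rewrite layer_prime1 // layer_prime2 // r1_lt_r2.
move=> x y eq_xy; case: (ltngtP (col x) (col y)) => [/neq|/neq|eq_col]; rewrite ?eq_xy ?eqxx //.
move: eq_xy; case: (col_cases x) => colx; have coly := colx; rewrite eq_col in coly.
- by rewrite !layer_prime0 // => /p_inj.
- by rewrite !layer_prime1 // => /r1_inj.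
by rewrite !layer_prime2 // => /r2_inj.
Qed.

Let commuting q1 q2 := exists u w, [/\ u \in G, w \in G, (q1 : nat).-elt u & (q2 : nat).-elt w] /\
  [/\ u != 1, w != 1 & commute u w].

Let commutingC q1 q2 : commuting q1 q2 -> commuting q2 q1.
Proof. by case=> u [w [[Gu Gw qu qw] [ntu ntw cuw]]]; exists w, u. Qed.

Let nt_order q (rT : finGroupType) (u : rT) : prime q -> #[u] = q -> q.-elt u /\ u != 1.
Proof.
move=> q_pr ou; split; first by rewrite /p_elt ou pnat_id.
by rewrite -order_eq1 ou neq_ltn prime_gt1 ?orbT.
Qed.

Let commuting_abelian (X : {group gT2}) q1 q2 : X \subset G -> abelian X -> prime q1 -> prime q2 ->
  (q1 %| #|X|)%N -> (q2 %| #|X|)%N -> commuting q1 q2.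
Proof.
move=> sXG abX q1_pr q2_pr /(Cauchy q1_pr)[u Xu ou] /(Cauchy q2_pr)[w Xw ow].
have [[qu ntu] [qw ntw]] := (nt_order q1_pr ou, nt_order q2_pr ow).
exists u, w; split; split=> //; first exact: (subsetP sXG).
  exact: (subsetP sXG).
exact: (centsP abX).
Qed.

Let f2_elt (q : nat) u : u \in H1 -> q.-elt u -> u != 1 -> [/\ f2 u \in G, q.-elt (f2 u) & f2 u != 1].
Proof.
move=> Hu qu ntu; split; last by rewrite morph_injm_eq1 ?(is_layer_injm lay2).
  by apply: (subsetP (is_layer_sub lay2)); apply: mem_morphim.
exact: morph_p_elt.
Qed.

Let f1_elt (q : nat) b : b \in T0 -> q.-elt b -> b != 1 -> [/\ f1 b \in H1, q.-elt (f1 b) & f1 b != 1].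
Proof.
move=> Tb qb ntb; split; last by rewrite morph_injm_eq1 ?(is_layer_injm lay1).
  by apply: (subsetP (is_layer_sub lay1)); apply: mem_morphim.
exact: morph_p_elt.
Qed.

(** Hence a subgroup of order [p o] meets [A2 i] trivially, and its generator has nonzero fixed
    vectors in the module induced from [A2 i]. *)
Let p'hit0 o i : col o = 0%N -> ~~ D o i -> ~~ (p o %| #|A2 i|)%N.
Proof.
move=> colo D'oi; have nC : f1 @* 'O_(hit0 i)(T0) \subset 'N(C).
  by apply: subset_trans (sub_f1 (pcore_sub _ _)) (normal_norm nsCH1).
rewrite /= norm_joinEr //; apply/negP=> pA.
have : (p o %| #|C| * #|f1 @* 'O_(hit0 i)(T0)|)%N by rewrite mul_cardG dvdn_mulr.
rewrite Euclid_dvdM // (negPf (p'C colo)) card_injm ?(is_layer_injm lay1) ?pcore_sub //= => pO.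
have: p o \in hit0 i.
  by apply: pnatPpi (pcore_pgroup _ T0) _; rewrite mem_primes p_pr cardG_gt0.
by rewrite mem_image_pred // colo (negPf D'oi).
Qed.

(** Equal colours share an abelian subgroup: the image of [T0], that of [C], or [W]. For colours 0
    and 1, or 1 and 2, the lower element lies in the kernel, [K1] or [K2], of the action on the
    upper Sylow subgroup. For 0 and 2 a nontrivial fixed vector comes from [<[f1 b]> :&: A2 y =
    1]. *)
Lemma commuting_layer_prime x y : (col x <= col y)%N -> ~~ D x y ->
  commuting (layer_prime x) (layer_prime y).
Proof.
have sWG := normal_sub (is_layer_normal lay2); have sH1G := is_layer_sub lay2.
case: (col_cases x) (col_cases y) => colx [] coly; rewrite colx coly // => _ D'xy.
- rewrite !layer_prime0 //; apply: (commuting_abelian (X := (f2 @* (f1 @* T0))%G)) => //.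
  + exact: subset_trans (morphimS _ (is_layer_sub lay1)) sH1G.
  + by rewrite !morphim_abelian.
  + by rewrite !card_injm ?(is_layer_injm lay2) ?(is_layer_injm lay1) ?(is_layer_sub lay1) ?p_T0.
  by rewrite !card_injm ?(is_layer_injm lay2) ?(is_layer_injm lay1) ?(is_layer_sub lay1) ?p_T0.
- have [b Tb ob] := Cauchy (p_pr x) (p_T0 colx); have [qb ntb] := nt_order (p_pr x) ob.
  have [u Ou ntu] := is_layer_pcore_neq1 lay1 (ind coly).
  have Hu := subsetP (normal_sub (is_layer_pcore_normal lay1 _)) u Ou.
  have cbu : commute (f1 b) u.
    apply: (is_layer_cent lay1 (j := ind coly)) => // z Tz.
    have -> : b ^ z = b by apply/conjg_fixP/commgP; apply: (centsP abT0).
    rewrite (mem_normal_Hall (nilpotent_pcore_Hall _ (abelian_nil abT0))) ?pcore_normal //.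
    by apply: sub_in_pnat qb => q _ /eqP->; rewrite mem_image_pred // colx D'xy.
  have [Hb qfb ntfb] := f1_elt Tb qb ntb.
  have qu := mem_p_elt (pcore_pgroup _ _) Ou.
  have [Gb2 qb2 ntb2] := f2_elt Hb qfb ntfb; have [Gu2 qu2 ntu2] := f2_elt Hu qu ntu.
  rewrite layer_prime0 // layer_prime1 //; exists (f2 (f1 b)), (f2 u); split; split=> //.
  by rewrite /commute -!morphM // cbu.
- have [b Tb ob] := Cauchy (p_pr x) (p_T0 colx); have [qb ntb] := nt_order (p_pr x) ob.
  have [Hb qfb ntfb] := f1_elt Tb qb ntb; have [Gb2 qb2 ntb2] := f2_elt Hb qfb ntfb.
  have tibA : <[f1 b]> :&: A2 y = 1.
    apply: coprime_TIg; rewrite -orderE order_injm ?(is_layer_injm lay1) // ob.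
    by rewrite prime_coprime ?p'hit0.
  have [w [Ow ntw cbw]] := is_layer_ex_commute lay2 (j := ind coly) Hb tibA.
  rewrite layer_prime0 // layer_prime2 //; exists (f2 (f1 b)), w; split; split=> //.
    by apply: (subsetP sWG); apply: (subsetP (pcore_sub _ _) _ Ow).
  exact: mem_p_elt (pcore_pgroup _ _) Ow.
- rewrite !layer_prime1 //; apply: (commuting_abelian (X := (f2 @* C)%G)) => //.
  + exact: subset_trans (morphimS _ (normal_sub nsCH1)) sH1G.
  + by rewrite morphim_abelian // cyclic_abelian.
  + by rewrite card_injm ?(is_layer_injm lay2) ?normal_sub ?r1_C.
  by rewrite card_injm ?(is_layer_injm lay2) ?normal_sub ?r1_C.
- have [u Ou ntu] := is_layer_pcore_neq1 lay1 (ind colx).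
  have [w Ow ntw] := is_layer_pcore_neq1 lay2 (ind coly).
  have Hu := subsetP (normal_sub (is_layer_pcore_normal lay1 _)) u Ou.
  have [Gu2 qu2 ntu2] := f2_elt Hu (mem_p_elt (pcore_pgroup _ _) Ou) ntu.
  rewrite layer_prime1 // layer_prime2 //; exists (f2 u), w; split; split=> //.
  + by apply: (subsetP sWG); apply: (subsetP (pcore_sub _ _) _ Ow).
  + exact: mem_p_elt (pcore_pgroup _ _) Ow.
  exact: commute_C_W colx coly D'xy Ou Ow.
rewrite !layer_prime2 //; apply: (commuting_abelian sWG) => //; rewrite ?r2_W //.
exact: is_layer_abelian lay2.
Qed.

Lemma layer_prime_commuting x y : symmetric D -> ~~ D x y -> exists u w,
  [/\ u \in G, w \in G, (layer_prime x).-elt u & (layer_prime y).-elt w] /\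
  [/\ u != 1, w != 1 & commute u w].
Proof.
move=> D_sym D'xy; have [le_xy | /ltnW le_yx] := leqP (col x) (col y).
  exact: commuting_layer_prime.
by apply/commutingC/commuting_layer_prime; rewrite // D_sym.
Qed.

Lemma layer_prime_no_common_cod x y : symmetric D -> col x != col y -> D x y ->
  no_common_cod G (layer_prime x) (layer_prime y).
Proof.
move=> D_sym; wlog lt_xy : x y / (col x < col y)%N.
  move=> IH neq_xy; case: (ltngtP (col x) (col y)) neq_xy => // [lt_xy | lt_yx] _ Dxy.
    by apply: IH => //; rewrite neq_ltn lt_xy.
  by apply: no_common_cod_sym; apply: IH => //; rewrite ?neq_ltn ?lt_yx // D_sym.
move=> _; move: lt_xy; case: (col_cases x) (col_cases y) => colx [] coly; rewrite colx coly // => _ Dxy.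
- by rewrite layer_prime0 // layer_prime1 //; apply: no_common_cod_01.
- by rewrite layer_prime0 // layer_prime2 //; apply: no_common_cod_02.
by rewrite layer_prime1 // layer_prime2 //; apply: no_common_cod_12.
Qed.

End TwoLayers.

(** * Construction of the group *)

Lemma exists_iso_codegree_graph (T : finType) (e : rel T) :
    simple_graph e -> triangle_free (compl_rel e) -> three_colorable (compl_rel e) ->
  exists (gT : finGroupType) (G : {group gT}), iso_codegree_graph e G.
Proof.
move=> simple_e tri_e [c cP]; set D := compl_rel e.
have D_sym : symmetric D by move=> x y; rewrite /D /compl_rel eq_sym (proj2 simple_e).
have D_tri x y z : D x y -> D y z -> D x z -> False.
  by move=> Dxy Dyz Dxz; apply: tri_e; exists x, y, z; apply/and3P.
pose col x : nat := val (c x).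
have D_col x y : D x y -> col x != col y by move/cP.
(* With [n = 1] the root condition puts no constraint on the primes, which only have to be
   distinct. *)
have [p [g0 [p_inj pP]]] := exists_primes_with_root T 0 (ltnSn 0).
have p_pr x : prime (p x) by have [] := pP x.
pose n1 := (\prod_(x | col x == 0%N) p x)%N.
have n1_gt0 : (0 < n1)%N by apply: prodn_cond_gt0 => x _; apply: prime_gt0.
pose T0 := [set: 'I_n1.-1.+1]%G.
have cardT0 : #|T0| = n1 by rewrite cardsT card_ord prednK.
have cycT0 : cyclic T0 by apply/cyclicP; exists Zp1; apply: Zp_cycle.
have p_T0 x : col x = 0%N -> (p x %| #|T0|)%N.
  by move=> colx; rewrite cardT0 /n1 (bigD1 x) ?colx //= dvdn_mulr.
have T0_p q : prime q -> (q %| #|T0|)%N -> exists2 x, col x = 0%N & q = p x.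
  rewrite cardT0 => q_pr; rewrite /n1; elim/big_rec: _ => [|x k /eqP colx IH].
    by rewrite dvdn1 => /eqP q1; rewrite q1 in q_pr.
  by rewrite Euclid_dvdM // dvdn_prime2 // => /orP[/eqP-> | /IH //]; exists x.
(* [n1 = #|T0|] is both the lower bound, keeping these primes away from [T0], and the order of the
   roots of unity, so that every quotient of [T0] has a faithful character modulo [r1 x]. *)
have [r1 [g1 [r1_inj r1P]]] := exists_primes_with_root T n1 n1_gt0.
have r1_pr x : prime (r1 x) by have [] := r1P x.
have r1_gt x : (#|T0| < r1 x)%N by rewrite cardT0; have [] := r1P x.
have [gT1 [H1 [C [f1 lay1]]]] : exists (hT : finGroupType) (H W : {group hT}) (f : {morphism T0 >-> hT}),
    is_layer (fun j : {x | col x == 1%N} => r1 (val j)) (fun=> T0) (fun j => K1 D col p T0 (val j)) H W f.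
  apply: (exists_layer (n := n1) (g := fun j => g1 (val j))) => //.
  - by move=> i j /r1_inj/val_inj.
  - by move=> j; have [] := r1P (val j).
  - by move=> j; apply: pcore_normal.
  - by move=> j; apply: quotient_cyclic.
  move=> j; apply: dvdn_trans (dvdn_quotient _ _) _.
  by rewrite cardT0.
(* This is the order of [H1], on which the second layer is built; every [#|A2 i / K2 i|] divides
   it. *)
pose n2 := (#|T0| * #|C|)%N.
have n2_gt0 : (0 < n2)%N by rewrite muln_gt0 !cardG_gt0.
have [r2 [g2 [r2_inj r2P]]] := exists_primes_with_root T n2 n2_gt0.
have r2_pr x : prime (r2 x) by have [] := r2P x.
have r2_gt x : (#|H1| < r2 x)%N.
  by rewrite (card_is_layer lay1) mulnC; have [] := r2P x.
have [gT2 [G [W [f2 lay2]]]] : exists (hT : finGroupType) (H W : {group hT}) (f : {morphism H1 >-> hT}),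
    is_layer (fun j : {x | col x == 2%N} => r2 (val j)) (fun j => A2 D col p C f1 (val j))
      (fun j => K2 D col r1 C (val j)) H W f.
  apply: (exists_layer (n := n2) (g := fun j => g2 (val j))) => //.
  - by move=> i j /r2_inj/val_inj.
  - by move=> j; have [] := r2P (val j).
  - by move=> j; apply: normal_sub (A2_normal lay1 _).
  - by move=> j; apply: K2_A2_normal lay1 _.
  - by move=> j; apply: (A2_K2_cyclic D_tri p_inj r1_inj cycT0 r1_gt lay1).
  by move=> j; apply: card_A2_K2_dvdn lay1 _.
have col_lt3 x : (col x < 3)%N by apply: ltn_ord.
exists gT2, G; apply: (iso_codegree_graph_intro (f := layer_prime col p r1 r2)) => //.
- by eapply layer_prime_inj; eauto.
- by eapply layer_prime_prime; eauto.
- by eapply layer_prime_dvd; eauto.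
- by eapply layer_prime_surj; eauto.
- by move=> x y _ D'xy; eapply layer_prime_commuting; eauto.
by move=> x y Dxy; eapply layer_prime_no_common_cod; eauto.
Qed.

Theorem theorem1p1 (T : finType) (e : rel T) :
  simple_graph e ->
  ((exists (gT : finGroupType) (G : {group gT}), iso_codegree_graph e G) <->
   (triangle_free (compl_rel e) /\ three_colorable (compl_rel e))).
Proof.
move=> simple_e; split=> [[gT [G isoG]] | [tri_e col_e]].
  exact: codegree_graph_compl isoG.
exact: exists_iso_codegree_graph.
Qed.
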